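(* For every fixed constant $r\ge1$, the problem $r$-DV ($r$-SP-AV control by deleting votes, with no restriction on the votes) is fixed-parameter tractable with respect to the parameter $R$, the maximum number of deleted votes.
   Context: An $r$-SP-AV election consists of a finite set of candidates and a finite multiset of votes, each vote being a linear order over all candidates. Each vote gives 1 point to each of the $r$ candidates in its top $r$ positions and 0 points to all others; the score of a candidate is its total number of points. A candidate is the unique winner if its score is strictly larger than that of every other candidate. Problem $r$-DV: Input: candidate set $\mathcal{C}\cup\{p\}$ with distinguished candidate $p$, a multiset $\Pi_{\mathcal{V}}$ of votes, and an integer $0\le R\le|\Pi_{\mathcal{V}}|$. Question: is there a submultiset $\Pi_{\mathcal{T}}$ of $\Pi_{\mathcal{V}}$ with at most $R$ votes such that $p$ is the unique winner of the election with votes $\Pi_{\mathcal{V}}\ominus\Pi_{\mathcal{T}}$? Fixed-parameter tractable means solvable in time $g(R)\cdot|I|^{O(1)}$ for a computable function $g$, where $|I|$ is the input size. *)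

(* Defs.v *)
From mathcomp Require Import all_boot.

Inductive move := MoveL | MoveR | MoveN.

Record TM := {
  tm_Q     : finType;
  tm_G     : finType;
  tm_blank : tm_G;
  tm_sym0  : tm_G;
  tm_sym1  : tm_G;
  tm_start : tm_Q;
  tm_halt  : tm_Q -> option bool;     (* Some true = accepting, Some false = rejecting halt state *)
  tm_delta : tm_Q -> tm_G -> tm_Q * tm_G * move
}.

Set Implicit Arguments. Unset Strict Implicit. Unset Printing Implicit Defensive.

(* configuration: state, tape left of head (nearest first), head symbol, tape right of head *)
Record config (M : TM) := Config {
  c_state : tm_Q M;
  c_left  : seq (tm_G M);
  c_head  : tm_G M;
  c_right : seq (tm_G M)
}.

Definition step (M : TM) (c : config M) : config M :=
  match tm_halt M (c_state c) with
  | Some _ => c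
  | None =>
    let: (q', a, mv) := tm_delta M (c_state c) (c_head c) in
    match mv with
    | MoveN => Config q' (c_left c) a (c_right c)
    | MoveL => match c_left c with
               | [::] => Config q' [::] (tm_blank M) (a :: c_right c)
               | x :: l' => Config q' l' x (a :: c_right c)
               end
    | MoveR => match c_right c with
               | [::] => Config q' (a :: c_left c) (tm_blank M) [::]
               | x :: r' => Config q' (a :: c_left c) x r'
               end
    end
  end.

Definition tm_sym (M : TM) (b : bool) : tm_G M := if b then tm_sym1 M else tm_sym0 M.

Definition init (M : TM) (w : seq bool) : config M :=
  let t := map (tm_sym M) w in
  Config (tm_start M) [::] (head (tm_blank M) t) (behead t).

Definition halts_with (M : TM) (w : seq bool) (t : nat) (b : bool) : Prop :=
  exists n, n <= t /\ tm_halt M (c_state (iter n (@step M) (init M w))) = Some b.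

(* Encodings (unary, self-delimiting)                                  *)

Definition enc_nat (k : nat) : seq bool := rcons (nseq k true) false.
Definition enc_list (s : seq nat) : seq bool :=
  enc_nat (size s) ++ flatten (map enc_nat s).

Definition tm_computable (g : nat -> nat) : Prop :=
  exists M : TM, forall k n, exists t, halts_with M (enc_nat k ++ enc_nat n) t (g k == n).

Definition FPT (X : Type) (valid : X -> Prop) (enc : X -> seq bool)
    (param : X -> nat) (P : X -> Prop) : Prop :=
  exists (M : TM) (g : nat -> nat) (c : nat),
    tm_computable g /\
    forall I, valid I ->
      exists b, halts_with M (enc I) (g (param I) * (size (enc I)).+1 ^ c) b
                /\ (b = true <-> P I).

(* candidates are 0, ..., dv_m - 1 (this is C ∪ {p}); p = dv_p;
   a vote is a linear order given as a list of all candidates, best first;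
   votes form a multiset (list); dv_R is the deletion budget R. *)
Record DVInstance := DVI {
  dv_m     : nat;
  dv_p     : nat;
  dv_votes : seq (seq nat);
  dv_R     : nat
}.

Definition dv_valid (I : DVInstance) : Prop :=
  dv_p I < dv_m I /\
  all (fun v => perm_eq v (iota 0 (dv_m I))) (dv_votes I) /\
  dv_R I <= size (dv_votes I).

Definition score (r : nat) (vs : seq (seq nat)) (c : nat) : nat :=
  count (fun v => c \in take r v) vs.

Definition unique_winner (r m p : nat) (vs : seq (seq nat)) : Prop :=
  forall c, c < m -> c != p -> score r vs c < score r vs p.

Definition rDV_yes (r : nat) (I : DVInstance) : Prop :=
  exists b : bitseq,
    size b = size (dv_votes I) /\ count id b <= dv_R I /\
    unique_winner r (dv_m I) (dv_p I) (mask (map negb b) (dv_votes I)).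

Definition encode_instance (I : DVInstance) : seq bool :=
  enc_nat (dv_m I) ++ enc_nat (dv_p I) ++ enc_nat (dv_R I) ++
  enc_nat (size (dv_votes I)) ++ flatten (map enc_list (dv_votes I)).

(* Main.v *)
(* Deleting votes approving p never helps, and to defeat c one must delete at
   least score(c) + 1 - score(p) votes approving c. If the total demand exceeds
   r R the answer is no, since R votes approve at most r R candidates in total.
   Otherwise a dynamic program over the votes not approving p keeps the set of
   reachable pairs (remaining budget, remaining demands); at most
   2^(R + r R) such pairs lie below the initial one, so without duplicates the
   set stays small.

   For Turing machines, the tape is split into five tracks holding stacks, and
   data are binary trees in preorder on one stack. The class FP mu of functions
   computed within time polynomial in mu is closed under pairing, conditionals
   and folds whose values have size polynomial in mu. The algorithm is a
   composition of such folds, for mu the input size plus 2^((r+1) R). *)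
Require Import Defs.
From mathcomp Require Import all_boot.
From mathcomp Require Import zify.
Set Implicit Arguments. Unset Strict Implicit. Unset Printing Implicit Defensive.

(** * Stack machines on a single tape *)

(** Among the rest, two deletion sets of equal size that leave the same demands have the same
    future; hence nothing else is remembered. Affordability is tested beforehand because a vector of
    demands with sum s has at most 2^s vectors below it, a bound in [R] alone only once s is at most
    r R. The obstacle is that the machine itself must be exhibited with its time bound. Polynomial
    time is not preserved by iteration, as sizes may double in each round; so every fold has to come
    with a bound on all its partial results. Measuring by mu instead of the input size lets the same
    closure lemmas cover the set of states, which is exponential in [R]. Preorder codes are
    self-delimiting, so an argument can be cut off the top of a stack without a stored length. The
    parameter function must be computable too: it is a power of 2, and the same calculus yields a
    machine that tests its graph. *)

Definition cell := {ffun 'I_5 -> option bool}.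
(* [None] marks the home position of the head, left of all stacks. *)
Definition sym := option cell.
Definition blankc : cell := [ffun=> None].
Definition setc (c : cell) (i : 'I_5) (o : option bool) : cell :=
  [ffun j => if j == i then o else c j].

(* A machine that stops with a value in [X], so that machines can be composed. *)
Record pm (X : Type) := PM {
  pq : finType;
  pq0 : pq;
  pd : pq -> sym -> (pq + X) * sym * move
}.

Definition tape : Type := (seq sym * sym * seq sym)%type.

Definition act (a : sym) (m : move) (t : tape) : tape :=
  let: (l, _, r) := t in
  match m with
  | MoveN => (l, a, r)
  | MoveL => if l is x :: l' then (l', x, a :: r) else ([::], Some blankc, a :: r)
  | MoveR => if r is x :: r' then (a :: l, x, r') else (a :: l, Some blankc, [::])
  end.

Inductive runs (X : Type) (M : pm X) : pq M -> tape -> nat -> X -> tape -> Prop :=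
| runs_exit q t x a m : pd q t.1.2 = (inr x, a, m) -> runs q t 1 x (act a m t)
| runs_step q t q' a m n x t' : pd q t.1.2 = (inl q', a, m) ->
    runs q' (act a m t) n x t' -> runs q t n.+1 x t'.

Definition pm_ret (X : Type) (x : X) : pm X :=
  @PM X unit tt (fun _ a => (inr x, a, MoveN)).

(** The continuation depends on the exit value, so its states form a sum over [X], finite because
    [X] is a [finType]. The exiting step of [M] itself enters [N x], so running times add
    exactly. *)
Definition pm_bind (X : finType) (Y : Type) (M : pm X) (N : X -> pm Y) : pm Y :=
  @PM Y (pq M + {x : X & pq (N x)})%type (inl (pq0 M))
    (fun q a => match q with
     | inl q1 => let: (o, b, m) := pd q1 a in
        (inl match o with
             | inl q' => inl q'
             | inr x => inr (Tagged (fun x => pq (N x)) (pq0 (N x)))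
             end, b, m)
     | inr (existT x q2) => let: (o, b, m) := pd q2 a in
        (match o with
         | inl q' => inl (inr (Tagged (fun x => pq (N x)) q'))
         | inr y => inr y
         end, b, m)
     end).

Definition pm_loop (Y : Type) (M : pm (option Y)) : pm Y :=
  @PM Y (pq M) (pq0 M)
    (fun q a => let: (o, b, m) := pd q a in
      (match o with
       | inl q' => inl q'
       | inr None => inl (pq0 M)
       | inr (Some y) => inr y
       end, b, m)).

Lemma runs_bind (X : finType) (Y : Type) (M : pm X) (N : X -> pm Y) q t n x t' n' y t'' :
  runs (M := M) q t n x t' -> runs (pq0 (N x)) t' n' y t'' ->
  runs (M := pm_bind M N) (inl q) t (n + n') y t''.
Proof.
move=> H1 H2; elim: H1 H2 => {q t n x t'} [q t x a m Hd|q t q' a m n x t' Hd _ IH] H2.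
  apply: (runs_step (M := pm_bind M N)); first by rewrite /= Hd.
  elim: H2 => [q2 u z b k Hd2|q2 u q' b k n2 z u' Hd2 _ IH2].
    by apply: (runs_exit (M := pm_bind M N)); rewrite /= Hd2.
  by apply: (runs_step (M := pm_bind M N)) IH2; rewrite /= Hd2.
by rewrite addSn; apply: (runs_step (M := pm_bind M N)) (IH H2); rewrite /= Hd.
Qed.

Lemma runs_loop_exit (Y : Type) (M : pm (option Y)) q t n y t' :
  runs (M := M) q t n (Some y) t' -> runs (M := pm_loop M) q t n y t'.
Proof.
move Ez: (Some y) => z H; elim: H Ez => {q t n z t'} [q t z a m Hd|q t q' a m n z t' Hd _ IH] Ez.
  by apply: (runs_exit (M := pm_loop M)); rewrite /= Hd -Ez.
by apply: (runs_step (M := pm_loop M)) (IH Ez); rewrite /= Hd.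
Qed.

Lemma runs_loop_next (Y : Type) (M : pm (option Y)) q t n t' n' y t'' :
  runs (M := M) q t n None t' -> runs (M := pm_loop M) (pq0 M) t' n' y t'' ->
  runs (M := pm_loop M) q t (n + n') y t''.
Proof.
move Ez: None => z H; elim: H Ez => {q t n z t'} [q t z a m Hd|q t q' a m n z t' Hd _ IH] Ez H2.
  by apply: (runs_step (M := pm_loop M)) H2; rewrite /= Hd -Ez.
by rewrite addSn; apply: (runs_step (M := pm_loop M)) (IH Ez H2); rewrite /= Hd.
Qed.

(** State [None] leaves the home marker, [Some true] walks right to the first free cell of track
    [i], and [Some false] returns. *)
Definition pm_push (i : 'I_5) (b : bool) : pm unit :=
  @PM unit (option bool) None
    (fun q a => match q, a with
     | None, _ => (inl (Some true), a, MoveR)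
     | Some true, Some c =>
         if c i is Some _ then (inl (Some true), a, MoveR)
         else (inl (Some false), Some (setc c i (Some b)), MoveL)
     | Some false, Some _ => (inl (Some false), a, MoveL)
     | _, None => (inr tt, a, MoveN)
     end).

(** State [inl true] walks to the first free cell of track [i], [inl false] erases the cell left of
    it, and [inr o] carries the erased symbol home. *)
Definition pm_pop (i : 'I_5) : pm (option bool) :=
  @PM (option bool) (option (bool + option bool)) None
    (fun q a => match q, a with
     | None, _ => (inl (Some (inl true)), a, MoveR)
     | Some (inl true), Some c =>
         if c i is Some _ then (inl (Some (inl true)), a, MoveR)
         else (inl (Some (inl false)), a, MoveL)
     | Some (inl false), Some c =>
         (inl (Some (inr (c i))), Some (setc c i None), MoveL)
     | Some (inr _), Some _ => (inl q, a, MoveL)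
     | Some (inr o), None => (inr o, a, MoveN)
     | _, None => (inr None, a, MoveN)
     end).

Definition stack (s : seq (seq bool)) (i : nat) : seq bool := nth [::] s i.

(* The bottom of each stack is next to the home marker, its top is furthest
   right; [r] may end with blank cells. *)
Definition rep (r : seq cell) (s : seq (seq bool)) : Prop :=
  forall (i : 'I_5) j, nth blankc r j i = onth (rev (stack s i)) j.

Definition home (L : seq sym) (r : seq cell) : tape := (L, None, map Some r).
Definition at_cell (L : seq sym) (u : seq cell) (c : cell) (r : seq cell) : tape :=
  (map Some u ++ None :: L, Some c, map Some r).

(** Moving right past the written tape appends a blank cell; the default value of [nth] makes such
    cells invisible to [rep]. *)
Lemma rep_rcons_blank r s : rep (rcons r blankc) s <-> rep r s.
Proof.
have E j : nth blankc (rcons r blankc) j = nth blankc r j.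
  rewrite nth_rcons; case: ltnP => // H; rewrite (nth_default _ H).
  by case: eqP.
by split=> H i j; rewrite -H E.
Qed.

Lemma act_right L u c r s : rep (rev u ++ c :: r) s ->
  exists c' r', act (Some c) MoveR (at_cell L u c r) = at_cell L (c :: u) c' r' /\
    rep (rev (c :: u) ++ c' :: r') s.
Proof.
case: r => [|c' r] H; last by exists c', r; split=> //; rewrite rev_cons cat_rcons.
exists blankc, [::]; split=> //; rewrite rev_cons cat_rcons.
by move/rep_rcons_blank: H; rewrite rcons_cat.
Qed.

Lemma act_right_home L r s : rep r s ->
  exists c' r', act None MoveR (home L r) = at_cell L [::] c' r' /\ rep (c' :: r') s.
Proof.
case: r => [|c' r] H; last by exists c', r.
by exists blankc, [::]; split=> //; move/rep_rcons_blank: H.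
Qed.

Lemma rep_head u c r s (i : 'I_5) : rep (rev u ++ c :: r) s ->
  c i = onth (rev (stack s i)) (size u).
Proof. by move=> H; rewrite -H nth_cat size_rev ltnn subnn. Qed.

Lemma rep_setc u c r s (i : 'I_5) o l : rep (rev u ++ c :: r) s ->
  (forall j, onth (rev l) j = if j == size u then o else onth (rev (stack s i)) j) ->
  rep (rev u ++ setc c i o :: r) (set_nth [::] s i l).
Proof.
move=> H Hl k j; rewrite /stack nth_set_nth /=; move: (H k j).
rewrite !nth_cat size_rev; case: ltngtP => Hj /=.
- by case: eqP => // /ord_inj ->; rewrite Hl ltn_eqF.
- have -> : nth blankc (setc c i o :: r) (j - size u) = nth blankc (c :: r) (j - size u).
    by case: (j - size u) (subn_gt0 (size u) j) => //; rewrite Hj.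
  by case: eqP => // /ord_inj ->; rewrite Hl gtn_eqF.
- rewrite -Hj subnn /= ffunE; case: eqP => [->|ne]; first by rewrite eqxx Hl Hj eqxx.
  by case: eqP => // /ord_inj.
Qed.

Lemma runs_back X (M : pm X) q x L r u c :
  (forall c, pd q (Some c) = (inl q, Some c, MoveL)) -> pd q None = (inr x, None, MoveN) ->
  runs (M := M) q (at_cell L u c r) (size u).+2 x (home L (rev u ++ c :: r)).
Proof.
move=> H1 H2; elim: u c r => [|d u IH] c r.
  apply: runs_step; first exact: H1.
  exact: (@runs_exit _ M q (L, None, Some c :: map Some r) x None MoveN).
rewrite rev_cons cat_rcons; apply: runs_step; first exact: H1.
exact: (IH d (c :: r)).
Qed.

Lemma runs_back_left X (M : pm X) q x L r u c :
  (forall c, pd q (Some c) = (inl q, Some c, MoveL)) -> pd q None = (inr x, None, MoveN) ->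
  runs (M := M) q (act (Some c) MoveL (at_cell L u c r)) (size u).+1 x
    (home L (rev u ++ c :: r)).
Proof.
move=> H1 H2; case: u => [|d u].
  exact: (@runs_exit _ M q (L, None, Some c :: map Some r) x None MoveN).
by rewrite rev_cons cat_rcons; apply: (@runs_back _ M q x L (c :: r) u d).
Qed.


(** On track [i] a cell is filled exactly below the height of the stack, so the walk stops at the
    first free cell. *)
Lemma runs_walk X (M : pm X) (q : pq M) s (i : 'I_5) L u c r :
  (forall c : cell, c i -> pd q (Some c) = (inl q, Some c, MoveR)) ->
  rep (rev u ++ c :: r) s -> size u <= size (stack s i) ->
  exists u' c' r', [/\ size u' = size (stack s i), rep (rev u' ++ c' :: r') s &
    forall n x t, runs (M := M) q (at_cell L u' c' r') n x t ->
      runs (M := M) q (at_cell L u c r) (size (stack s i) - size u + n) x t].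
Proof.
move=> Hq; move Ed: (size (stack s i) - size u) => d.
elim: d u c r Ed => [|d IH] u c r Ed Hr Hu.
  by exists u, c, r; split=> //; apply/eqP; rewrite eqn_leq Hu -subn_eq0 Ed.
have ltu : size u < size (stack s i) by rewrite -subn_gt0 Ed.
have ci : c i by rewrite (rep_head _ Hr) onthTE size_rev.
have [c1 [r1 [E1 R1]]] := act_right L Hr.
have [||u' [c' [r' [S' R' H']]]] := IH (c :: u) c1 r1 _ R1 => //=.
  by rewrite subnS Ed.
exists u', c', r'; split=> // n x t /H' Hn; rewrite addSn.
apply: (@runs_step _ M q (at_cell L u c r) _ _ _ _ _ _ (Hq _ ci)).
by rewrite E1.
Qed.

(* [n] counts stack operations and bounds the growth of the stacks; one operation
   on stacks of height at most [h] costs at most [2 * h + 6] machine steps. *)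
Variant exec (X : Type) (M : pm X) (s : seq (seq bool)) (n : nat) (x : X)
    (s' : seq (seq bool)) : Prop :=
  Exec of forall B L r, (forall i, size (stack s i) <= B) -> rep r s ->
    (forall i, size (stack s' i) <= B + n) /\
    exists k r', [/\ k <= n * (2 * (B + n) + 6), rep r' s' &
      runs (pq0 M) (home L r) k x (home L r')].

Lemma exec_le (X : Type) (M : pm X) s n n' x s' : n <= n' -> exec M s n x s' -> exec M s n' x s'.
Proof.
move=> le [H]; split=> B L r HB Hr; have [H1 [k [r' [Hk H2 H3]]]] := H B L r HB Hr.
split=> [i|]; first by apply: leq_trans (H1 i) _; rewrite leq_add2l.
exists k, r'; split=> //; apply: leq_trans Hk _.
by apply: leq_mul => //; rewrite leq_add2r leq_mul2l leq_add2l.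
Qed.

Lemma exec_ret (X : Type) (x : X) s : exec (pm_ret x) s 1 x s.
Proof.
split=> B L r HB Hr; split=> [i|]; first by apply: leq_trans (HB i) _; rewrite leq_addr.
exists 1, r; split=> //; first lia.
exact: (@runs_exit _ (pm_ret x) tt (home L r) x None MoveN).
Qed.

Lemma exec_bind (X : finType) (Y : Type) (M : pm X) (N : X -> pm Y) s n x s' n' y s'' :
  exec M s n x s' -> exec (N x) s' n' y s'' -> exec (pm_bind M N) s (n + n') y s''.
Proof.
move=> [H1] [H2]; split=> B L r HB Hr; have [B1 [k [r' [Hk R1 E1]]]] := H1 B L r HB Hr.
have [B2 [k' [r'' [Hk' R2 E2]]]] := H2 _ L r' B1 R1.
split=> [i|]; first by rewrite addnA.
exists (k + k'), r''; split=> //; first by nia.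
exact: runs_bind E1 E2.
Qed.

Lemma exec_loop_exit (Y : Type) (M : pm (option Y)) s n y s' :
  exec M s n (Some y) s' -> exec (pm_loop M) s n y s'.
Proof.
move=> [H]; split=> B L r HB Hr; have [B1 [k [r' [Hk R1 E1]]]] := H B L r HB Hr.
by split=> //; exists k, r'; split=> //; apply: runs_loop_exit.
Qed.

Lemma exec_loop_next (Y : Type) (M : pm (option Y)) s n s' n' y s'' :
  exec M s n None s' -> exec (pm_loop M) s' n' y s'' -> exec (pm_loop M) s (n + n') y s''.
Proof.
move=> [H1] [H2]; split=> B L r HB Hr; have [B1 [k [r' [Hk R1 E1]]]] := H1 B L r HB Hr.
have [B2 [k' [r'' [Hk' R2 E2]]]] := H2 _ L r' B1 R1.
split=> [i|]; first by rewrite addnA.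
exists (k + k'), r''; split=> //; first by nia.
exact: runs_loop_next E1 E2.
Qed.

Lemma exec_push (i : 'I_5) b s :
  exec (pm_push i b) s 1 tt (set_nth [::] s i (b :: stack s i)).
Proof.
split=> B L r HB Hr; split=> [j|].
  rewrite /stack nth_set_nth /=; case: eqP => _ /=; rewrite addn1 ?ltnS; first exact: HB.
  exact: leqW (HB j).
have [c [r1 [E1 R1]]] := act_right_home L Hr.
have [|u [c' [r2 [Su R2 W]]]] := runs_walk (M := pm_push i b) (q := Some true) (i := i) (u := [::]) L _ R1 (leq0n _).
  by move=> d; case E: (d i) => [x|] //= _; rewrite E.
exists (1 + (size (stack s i) + (1 + (size u).+1))), (rev u ++ setc c' i (Some b) :: r2); split.
- have := HB i; rewrite Su; lia.
- apply: rep_setc R2 _ => j; rewrite rev_cons -cats1 onth_cat size_rev Su.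
  case: ltngtP => // [Hj|->]; last by rewrite subnn.
  rewrite [RHS]onth_default ?size_rev 1?ltnW //.
  by rewrite onth_default // subn_gt0.
apply: (@runs_step _ (pm_push i b) None (home L r) (Some true) None MoveR) => //.
rewrite [act _ _ _]E1 -[size _]subn0; apply: W.
have ci : c' i = None.
  by rewrite (rep_head i R2) onth_default // size_rev Su.
apply: (@runs_step _ (pm_push i b) (Some true) (at_cell L u c' r2) (Some false)
  (Some (setc c' i (Some b))) MoveL); first by rewrite /= ci.
exact: (@runs_back_left _ (pm_push i b) (Some false) tt L r2 u).
Qed.

Lemma exec_pop (i : 'I_5) s :
  exec (pm_pop i) s 1 (ohead (stack s i)) (set_nth [::] s i (behead (stack s i))).
Proof.
split=> B L r HB Hr; split=> [j|].
  rewrite /stack nth_set_nth /=; case: eqP => _ /=; last exact: leq_trans (HB j) (leq_addr _ _).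
  by rewrite size_behead; have := HB i; rewrite /stack; lia.
have [c [r1 [E1 R1]]] := act_right_home L Hr.
have [|u [c' [r2 [Su R2 W]]]] := runs_walk (M := pm_pop i) (q := Some (inl true)) (i := i) (u := [::]) L _ R1 (leq0n _).
  by move=> d; case E: (d i) => [x|] //= _; rewrite E.
have ci : c' i = None.
  by rewrite (rep_head i R2) onth_default // size_rev Su.
have Hs1 : forall n x t, runs (M := pm_pop i) (Some (inl false)) (act (Some c') MoveL (at_cell L u c' r2)) n x t ->
    runs (M := pm_pop i) None (home L r) (1 + (size (stack s i) + (1 + n))) x t.
  move=> n x t Hn; apply: (@runs_step _ (pm_pop i) None (home L r) (Some (inl true)) None MoveR) => //.
  rewrite [act _ _ _]E1 -[size _]subn0; apply: W.
  by apply: (@runs_step _ (pm_pop i) (Some (inl true)) (at_cell L u c' r2)) Hn; rewrite /= ci.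
(* If [u] is empty, there is no cell to erase: one move left brings the head onto the home marker,
   which is how an empty stack is noticed. *)
case: u Su R2 W Hs1 => [|d u] Su R2 W Hs1.
  have E0 : stack s i = [::] by apply: size0nil.
  exists (1 + (size (stack s i) + (1 + 1))), (c' :: r2); split; first by rewrite E0 /=; lia.
    move=> k j; rewrite R2 /stack nth_set_nth /=; case: eqP => // ->.
    by rewrite [nth _ _ _]E0.
  apply: Hs1; rewrite E0.
  exact: (@runs_exit _ (pm_pop i) (Some (inl false)) (act (Some c') MoveL (at_cell L [::] c' r2))
    None None MoveN).
rewrite rev_cons cat_rcons in R2.
exists (1 + (size (stack s i) + (1 + (1 + (size u).+1)))), (rev u ++ setc d i None :: c' :: r2).
split; first by have := HB i; rewrite -Su /=; lia.
  apply: rep_setc R2 _ => j.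
  case E: (stack s i) Su => [//|b l] [Su] /=.
  rewrite rev_cons -cats1 onth_cat size_rev -Su.
  case: ltngtP => // [Hj|->]; last by rewrite onth_default // size_rev Su.
  by rewrite !onth_default ?size_rev //= ?subn_gt0 // -Su ltnW.
apply: Hs1; apply: (@runs_step _ (pm_pop i) (Some (inl false)) (at_cell L u d (c' :: r2))
  (Some (inr (d i))) (Some (setc d i None)) MoveL) => //.
have -> : ohead (stack s i) = d i.
  rewrite (rep_head i R2); case E: (stack s i) Su => [//|b l] [->] /=.
  by rewrite rev_cons -cats1 onth_cat size_rev ltnn subnn.
exact: (@runs_back_left _ (pm_pop i) (Some (inr (d i))) (d i) L (c' :: r2) u).
Qed.

(** * Binary trees on stacks *)

Notation "M ;; N" := (pm_bind M (fun=> N)) (at level 60, right associativity).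

Definition rD : 'I_5 := @Ordinal 5 0 isT.
Definition rS : 'I_5 := @Ordinal 5 1 isT.
Definition rA : 'I_5 := @Ordinal 5 2 isT.
Definition rB : 'I_5 := @Ordinal 5 3 isT.
Definition rC : 'I_5 := @Ordinal 5 4 isT.

Inductive tree := Leaf | Node of tree & tree.

Fixpoint code (t : tree) : seq bool :=
  if t is Node a b then true :: code a ++ code b else [:: false].

(** Preorder codes are prefix-free. The arbitrary continuations let the induction pass from the left
    subtree to the right one. *)
Lemma code_cat_inj t t' w w' : code t ++ w = code t' ++ w' -> t = t' /\ w = w'.
Proof.
elim: t t' w w' => [|a IHa b IHb] [|a' b'] w w' //=; first by case.
by case; rewrite -!catA => /IHa [-> /IHb [-> ->]].
Qed.

Lemma code_inj : injective code.
Proof. by move=> t t' E; have [] := @code_cat_inj t t' [::] [::]; rewrite ?cats0. Qed.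

(* [D] is the data stack, [S] keeps values aside during loops; the other three
   are scratch. *)
Definition st (D S : seq bool) : seq (seq bool) := [:: D; S; [::]; [::]; [::]].

(** [F] is any arrangement of the stacks with [x] and [y] on tracks [i] and [j], so a loop is
    verified once and reused for several pairs of tracks. *)
Definition two_stacks (i j : 'I_5) (F : seq bool -> seq bool -> seq (seq bool)) : Prop :=
  forall x y, [/\ stack (F x y) i = x, stack (F x y) j = y,
    forall z, set_nth [::] (F x y) i z = F z y &
    forall z, set_nth [::] (F x y) j z = F x z].

Lemma exec_push2 i j F b x y : two_stacks i j F ->
  exec (pm_push j b) (F x y) 1 tt (F x (b :: y)).
Proof. by case/(_ x y) => _ Ej _ Sj; have := exec_push j b (F x y); rewrite Ej Sj. Qed.

Lemma exec_pop2 i j F x y : two_stacks i j F ->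
  exec (pm_pop i) (F x y) 1 (ohead x) (F (behead x) y).
Proof. by case/(_ x y) => Ei _ Si _; have := exec_pop i (F x y); rewrite Ei Si. Qed.

Arguments exec_push2 {i j F} b {x y}.
Arguments exec_pop2 {i j F x y}.

Definition pm_drain (i : 'I_5) : pm unit :=
  pm_loop (pm_bind (pm_pop i) (fun o => pm_ret (if o is Some _ then None else Some tt))).

Lemma exec_drain i j F x y : two_stacks i j F ->
  exec (pm_drain i) (F x y) (2 * size x + 2) tt (F [::] y).
Proof.
move=> HF; elim: x => [|b x IH].
  by apply: exec_loop_exit; apply: (exec_bind (n := 1) (n' := 1) (exec_pop2 HF)); apply: exec_ret.
rewrite /= mulnS -addnA; apply: exec_loop_next IH.
by apply: (exec_bind (n := 1) (n' := 1) (exec_pop2 HF)); apply: exec_ret.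
Qed.

Definition pm_pour (i j : 'I_5) : pm unit :=
  pm_loop (pm_bind (pm_pop i) (fun o =>
    if o is Some b then pm_push j b ;; pm_ret None else pm_ret (Some tt))).

Lemma exec_pour i j F x y : two_stacks i j F ->
  exec (pm_pour i j) (F x y) (3 * size x + 2) tt (F [::] (rev x ++ y)).
Proof.
move=> HF; elim: x y => [|b x IH] y.
  by apply: exec_loop_exit; apply: (exec_bind (n := 1) (n' := 1) (exec_pop2 HF)); apply: exec_ret.
rewrite /= mulnS -addnA rev_cons cat_rcons; apply: exec_loop_next (IH _).
apply: (exec_bind (n := 1) (n' := 2) (exec_pop2 HF)).
by apply: (exec_bind (n := 1) (n' := 1)); [exact: (exec_push2 _ HF) | exact: exec_ret].
Qed.

(* Since pouring reverses, this is how a popped tree is copied. *)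
Definition pm_pour2 (i j k : 'I_5) : pm unit :=
  pm_loop (pm_bind (pm_pop i) (fun o =>
    if o is Some b then pm_push j b ;; pm_push k b ;; pm_ret None else pm_ret (Some tt))).

Lemma exec_pour2 D S A B :
  exec (pm_pour2 rA rD rB) [:: D; S; A; B; [::]] (4 * size A + 2) tt
    [:: rev A ++ D; S; [::]; rev A ++ B; [::]].
Proof.
elim: A B D => [|b x IH] B D.
  by apply: exec_loop_exit; apply: (exec_bind (n := 1) (n' := 1) (exec_pop rA _)); apply: exec_ret.
rewrite /= mulnS -addnA rev_cons !cat_rcons; apply: exec_loop_next (IH _ _).
apply: (exec_bind (n := 1) (n' := 3) (exec_pop rA _)).
apply: (exec_bind (n := 1) (n' := 2) (exec_push rD _ _)).
apply: (exec_bind (n := 1) (n' := 1) (exec_push rB _ _)).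
exact: exec_ret.
Qed.

(* Stack [C] counts, in unary, the subtrees still to be read. *)
Definition pm_take_body (i j : 'I_5) : pm (option unit) :=
  pm_bind (pm_pop rC) (fun o => if o is Some _ then
    pm_bind (pm_pop i) (fun o' => match o' with
      | Some true => pm_push j true ;; pm_push rC true ;; pm_push rC true ;; pm_ret None
      | Some false => pm_push j false ;; pm_ret None
      | None => pm_ret (Some tt)
      end) else pm_ret (Some tt)).

Definition pm_take (i j : 'I_5) : pm unit := pm_push rC true ;; pm_loop (pm_take_body i j).


(** A leaf lowers the counter by one and a node raises it by one, so a complete tree uses up exactly
    one unit. The rest of the run is a premise, so that the two subtrees of a node can be
    chained. *)
Lemma exec_take_loop i j F t x y c n z :
  (forall c, two_stacks i j (fun x y => F x y c)) ->
  (forall x, two_stacks rC j (fun c y => F x y c)) ->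
  (forall y, two_stacks i rC (fun x c => F x y c)) ->
  exec (pm_loop (pm_take_body i j)) (F x (rev (code t) ++ y) (nseq c true)) n tt z ->
  exec (pm_loop (pm_take_body i j)) (F (code t ++ x) y (nseq c.+1 true))
    (6 * size (code t) + n) tt z.
Proof.
move=> Hij HCj HiC; elim: t x y c n => [|a IHa b IHb] x y c n H.
  apply: (exec_le (n := 4 + n)); first by rewrite leq_add2r.
  apply: exec_loop_next H.
  apply: (exec_bind (n := 1) (n' := 3) (exec_pop2 (HCj _))).
  apply: (exec_bind (n := 1) (n' := 2) (exec_pop2 (Hij _))).
  by apply: (exec_bind (n := 1) (n' := 1)); [exact: (exec_push2 _ (Hij _)) | exact: exec_ret].
have -> : 6 * size (code (Node a b)) + n
    = 6 + (6 * size (code a) + (6 * size (code b) + n)) by rewrite /= size_cat; lia.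
apply: exec_loop_next (IHa (code b ++ x) (true :: y) c.+1 _ (IHb _ _ _ _ _)); last first.
  by move: H; rewrite /= rev_cons rev_cat -cats1 -!catA.
rewrite catA.
apply: (exec_bind (n := 1) (n' := 5) (exec_pop2 (HCj _))).
apply: (exec_bind (n := 1) (n' := 4) (exec_pop2 (Hij _))).
apply: (exec_bind (n := 1) (n' := 3) (exec_push2 _ (Hij _))).
apply: (exec_bind (n := 1) (n' := 2) (exec_push2 _ (HiC _))).
by apply: (exec_bind (n := 1) (n' := 1)); [exact: (exec_push2 _ (HiC _)) | exact: exec_ret].
Qed.

Lemma exec_take i j F t x y :
  (forall c, two_stacks i j (fun x y => F x y c)) ->
  (forall x, two_stacks rC j (fun c y => F x y c)) ->
  (forall y, two_stacks i rC (fun x c => F x y c)) ->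
  exec (pm_take i j) (F (code t ++ x) y [::]) (6 * size (code t) + 3) tt
    (F x (rev (code t) ++ y) [::]).
Proof.
move=> Hij HCj HiC; have -> : 6 * size (code t) + 3 = 1 + (6 * size (code t) + 2) by lia.
apply: (exec_bind (n := 1) (exec_push2 true (HiC _))).
apply: (exec_take_loop (c := 0)) => //; apply: exec_loop_exit.
by apply: (exec_bind (n := 1) (n' := 1)); [exact: (exec_pop2 (HCj _)) | exact: exec_ret].
Qed.

Arguments exec_take {i j F t x y}.
Arguments exec_drain {i j F x y}.
Arguments exec_pour {i j F x y}.

(** * Moving, copying and comparing whole trees *)

Definition sz (t : tree) : nat := size (code t).

(** No code is empty, so additive constants are absorbed and the costs of tree operations become
    multiples of sizes. *)
Lemma sz_gt0 t : 0 < sz t. Proof. by case: t. Qed.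

Lemma exec_take_DA t D S A B :
  exec (pm_take rD rA) [:: code t ++ D; S; A; B; [::]] (9 * sz t) tt
    [:: D; S; rev (code t) ++ A; B; [::]].
Proof.
apply: exec_le _ (exec_take (F := fun x y c => [:: x; S; y; B; c]) _ _ _) => //.
by have := sz_gt0 t; rewrite /sz; lia.
Qed.

Lemma exec_take_DB t D S A B :
  exec (pm_take rD rB) [:: code t ++ D; S; A; B; [::]] (9 * sz t) tt
    [:: D; S; A; rev (code t) ++ B; [::]].
Proof.
apply: exec_le _ (exec_take (F := fun x y c => [:: x; S; A; y; c]) _ _ _) => //.
by have := sz_gt0 t; rewrite /sz; lia.
Qed.

Lemma exec_take_SA t D S A B :
  exec (pm_take rS rA) [:: D; code t ++ S; A; B; [::]] (9 * sz t) tt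
    [:: D; S; rev (code t) ++ A; B; [::]].
Proof.
apply: exec_le _ (exec_take (F := fun x y c => [:: D; x; y; B; c]) _ _ _) => //.
by have := sz_gt0 t; rewrite /sz; lia.
Qed.

Lemma exec_pour_tree t i j F y : two_stacks i j F ->
  exec (pm_pour i j) (F (rev (code t)) y) (5 * sz t) tt (F [::] (code t ++ y)).
Proof.
move=> HF; rewrite -{2}[code t]revK; apply: exec_le _ (exec_pour HF).
by have := sz_gt0 t; rewrite size_rev /sz; lia.
Qed.

Arguments exec_pour_tree t {i j F} y.

Definition pm_drop : pm unit := pm_take rD rA ;; pm_drain rA.
(** The double pour leaves one copy on [rD] and one on [rB], both in reading order; the detour
    through [rA] reverses the second copy twice, so it arrives in order. *)
Definition pm_dup : pm unit :=
  pm_take rD rA ;; pm_pour2 rA rD rB ;; pm_pour rB rA ;; pm_pour rA rD.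
Definition pm_swap : pm unit :=
  pm_take rD rA ;; pm_take rD rB ;; pm_pour rA rD ;; pm_pour rB rD.
Definition pm_save : pm unit := pm_take rD rA ;; pm_pour rA rS.
Definition pm_restore : pm unit := pm_take rS rA ;; pm_pour rA rD.

Lemma exec_drop t D S : exec pm_drop (st (code t ++ D) S) (13 * sz t) tt (st D S).
Proof.
have -> : 13 * sz t = 9 * sz t + 4 * sz t by lia.
apply: exec_bind (exec_take_DA _ _ _ _ _) _; rewrite cats0.
apply: exec_le _ (exec_drain (F := fun x y => [:: D; y; x; [::]; [::]]) (j := rS) _) => //.
by have := sz_gt0 t; rewrite size_rev /sz; lia.
Qed.

Lemma exec_dup t D S :
  exec pm_dup (st (code t ++ D) S) (25 * sz t) tt (st (code t ++ code t ++ D) S).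
Proof.
have -> : 25 * sz t = 9 * sz t + (6 * sz t + (5 * sz t + 5 * sz t)) by lia.
apply: exec_bind (exec_take_DA _ _ _ _ _) _; rewrite cats0.
apply: exec_bind.
  apply: exec_le _ (exec_pour2 _ _ _ _).
  by have := sz_gt0 t; rewrite size_rev /sz; lia.
rewrite revK cats0; apply: exec_bind.
  apply: exec_le _ (exec_pour (y := [::]) (F := fun x y => [:: code t ++ D; S; y; x; [::]]) _) => //.
  by have := sz_gt0 t; rewrite /sz; lia.
rewrite cats0.
exact: (exec_pour_tree t _ (F := fun x y => [:: y; S; x; [::]; [::]])).
Qed.

Lemma exec_swap t u D S :
  exec pm_swap (st (code t ++ code u ++ D) S) (14 * (sz t + sz u)) tt
    (st (code u ++ code t ++ D) S).
Proof.
have -> : 14 * (sz t + sz u) = 9 * sz t + (9 * sz u + (5 * sz t + 5 * sz u)) by lia.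
apply: exec_bind (exec_take_DA _ _ _ _ _) _; rewrite cats0.
apply: exec_bind (exec_take_DB _ _ _ _ _) _; rewrite cats0.
apply: exec_bind.
  exact: (exec_pour_tree t _ (F := fun x y => [:: y; S; x; _; [::]])).
exact: (exec_pour_tree u _ (F := fun x y => [:: y; S; [::]; x; [::]])).
Qed.

Lemma exec_save t D S :
  exec pm_save (st (code t ++ D) S) (14 * sz t) tt (st D (code t ++ S)).
Proof.
have -> : 14 * sz t = 9 * sz t + 5 * sz t by lia.
apply: exec_bind (exec_take_DA _ _ _ _ _) _; rewrite cats0.
exact: (exec_pour_tree t _ (F := fun x y => [:: D; y; x; [::]; [::]])).
Qed.

Lemma exec_restore t D S :
  exec pm_restore (st D (code t ++ S)) (14 * sz t) tt (st (code t ++ D) S).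
Proof.
have -> : 14 * sz t = 9 * sz t + 5 * sz t by lia.
apply: exec_bind (exec_take_SA _ _ _ _ _) _; rewrite cats0.
exact: (exec_pour_tree t _ (F := fun x y => [:: y; S; x; [::]; [::]])).
Qed.

Fixpoint pm_puts (w : seq bool) : pm unit :=
  if w is b :: w' then pm_puts w' ;; pm_push rD b else pm_ret tt.

Lemma exec_puts v D S A B C :
  exec (pm_puts v) [:: D; S; A; B; C] (size v).+1 tt [:: v ++ D; S; A; B; C].
Proof.
elim: v => [|b v IH] /=; first exact: exec_ret.
by rewrite -[(size v).+2]addn1; apply: exec_bind IH (exec_push rD _ _).
Qed.

Definition pm_eqAB : pm bool :=
  pm_loop (pm_bind (pm_pop rA) (fun o => pm_bind (pm_pop rB) (fun o' =>
    pm_ret (if o == o' then if o is Some _ then None else Some true else Some false)))).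

(** The loop stops at the first mismatch and leaves remainders [A'] and [B']; their size bounds pay
    for draining them afterwards. *)
Lemma exec_eqAB D S A B : exists A' B', size A' <= size A /\ size B' <= size B /\
  exec pm_eqAB [:: D; S; A; B; [::]] (3 * size A + 3) (A == B) [:: D; S; A'; B'; [::]].
Proof.
elim: A B => [|a A IH] [|b B].
- exists [::], [::]; do 2!split=> //; apply: exec_loop_exit.
  apply: (exec_bind (n := 1) (n' := 2) (exec_pop rA _)).
  by apply: (exec_bind (n := 1) (n' := 1)); [exact: exec_pop | exact: exec_ret].
- exists [::], B; do 2!split=> //=; apply: exec_loop_exit.
  apply: (exec_bind (n := 1) (n' := 2) (exec_pop rA _)).
  by apply: (exec_bind (n := 1) (n' := 1)); [exact: exec_pop | exact: exec_ret].
- exists A, [::]; do 2!split=> //=; apply: exec_loop_exit.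
  apply: (exec_le (n := 3)); first by rewrite leq_addl.
  apply: (exec_bind (n := 1) (n' := 2) (exec_pop rA _)).
  by apply: (exec_bind (n := 1) (n' := 1)); [exact: exec_pop | exact: exec_ret].
rewrite eqseq_cons; case: eqP => [<-|ne].
  have [A' [B' [HA [HB H]]]] := IH B; exists A', B'; rewrite !leqW //; do 2!split=> //.
  rewrite /= mulnS -addnA; apply: exec_loop_next H.
  apply: (exec_bind (n := 1) (n' := 2) (exec_pop rA _)).
  apply: (exec_bind (n := 1) (n' := 1) (exec_pop rB _)) => /=.
  by have := exec_ret (@None bool) [:: D; S; A; B; [::]]; rewrite eqxx.
exists A, B; do 2!split=> //=; apply: exec_loop_exit.
apply: (exec_le (n := 3)); first by rewrite leq_addl.
apply: (exec_bind (n := 1) (n' := 2) (exec_pop rA _)).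
apply: (exec_bind (n := 1) (n' := 1) (exec_pop rB _)) => /=.
have := exec_ret (Some false) [:: D; S; A; B; [::]].
by have /negbTE -> : Some a != Some b by apply/eqP => -[].
Qed.

Definition tbool (b : bool) : tree := if b then Node Leaf Leaf else Leaf.

Definition pm_eq : pm unit :=
  pm_take rD rA ;; pm_take rD rB ;;
  pm_bind pm_eqAB (fun b => pm_drain rA ;; pm_drain rB ;; pm_puts (code (tbool b))).

Lemma exec_eq t u D S (b : bool) : reflect (t = u) b ->
  exec pm_eq (st (code t ++ code u ++ D) S) (30 * (sz t + sz u)) tt
    (st (code (tbool b) ++ D) S).
Proof.
move=> Hb; have [A' [B' [HA [HB HE]]]] := exec_eqAB D S (rev (code t)) (rev (code u)).
rewrite !size_rev -!/(sz _) in HA HB HE.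
apply: (exec_le (n := 9 * sz t + (9 * sz u + (3 * sz t + 3 + (2 * sz t + 2 + (2 * sz u + 2 + 4)))))).
  by have := sz_gt0 t; have := sz_gt0 u; lia.
apply: exec_bind (exec_take_DA _ _ _ _ _) _; rewrite cats0.
apply: exec_bind (exec_take_DB _ _ _ _ _) _; rewrite cats0.
apply: exec_bind HE _.
have -> : (rev (code t) == rev (code u)) = b.
  apply/idP/Hb => [/eqP/(can_inj revK)/code_inj //|->]; exact: eqxx.
apply: exec_bind.
  apply: exec_le _ (exec_drain (F := fun x y => [:: D; y; x; B'; [::]]) (j := rS) _) => //.
  lia.
apply: exec_bind.
  apply: exec_le _ (exec_drain (F := fun x y => [:: D; y; [::]; x; [::]]) (j := rS) _) => //.
  lia.
by apply: exec_le _ (exec_puts _ _ _ _ _ _); case: (b).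
Qed.

(** * Functions computed in polynomial time *)

(** Injectivity makes a comparison of trees decide equality of values, as in [FP_eq]. *)
Class encodable (A : Type) := { enc : A -> tree; enc_inj : injective enc }.

(** A number has the tree of a list of that many units, so iteration is a special case of a fold. *)
Fixpoint tnat (n : nat) : tree := if n is n'.+1 then Node Leaf (tnat n') else Leaf.

Fixpoint tseq (A : Type) (f : A -> tree) (l : seq A) : tree :=
  if l is a :: l' then Node (f a) (tseq f l') else Leaf.

Lemma tnat_inj : injective tnat.
Proof. by elim=> [|n IH] [|m] //= [/IH ->]. Qed.

Lemma tbool_inj : injective tbool.
Proof. by do 2!case. Qed.

Lemma tunit_inj : injective (fun _ : unit => Leaf).
Proof. by do 2!case. Qed.

Lemma tpair_inj (A B : Type) (f : A -> tree) (g : B -> tree) :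
  injective f -> injective g -> injective (fun p => Node (f p.1) (g p.2)).
Proof. by move=> Hf Hg [a b] [a' b'] /= [/Hf -> /Hg ->]. Qed.

Lemma tseq_inj (A : Type) (f : A -> tree) : injective f -> injective (tseq f).
Proof. by move=> Hf; elim=> [|a l IH] [|a' l'] //= [/Hf -> /IH ->]. Qed.

#[export] Instance encodable_nat : encodable nat := {| enc_inj := tnat_inj |}.
#[export] Instance encodable_bool : encodable bool := {| enc_inj := tbool_inj |}.
#[export] Instance encodable_unit : encodable unit := {| enc_inj := tunit_inj |}.
#[export] Instance encodable_prod A B {HA : encodable A} {HB : encodable B} : encodable (A * B) :=
  {| enc_inj := tpair_inj enc_inj enc_inj |}.
#[export] Instance encodable_seq A {HA : encodable A} : encodable (seq A) :=
  {| enc_inj := tseq_inj enc_inj |}.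

Definition esz {A : Type} {HA : encodable A} (x : A) : nat := sz (enc x).

(** The base is at least 2, so one power absorbs constants, sums and products, and no coefficients
    are carried. *)
Definition poly (X : Type) (mu h : X -> nat) : Prop :=
  exists k, forall x, h x <= (mu x).+2 ^ k.

Lemma poly_le (X : Type) (mu h h' : X -> nat) :
  poly mu h' -> (forall x, h x <= h' x) -> poly mu h.
Proof. by move=> [k Hk] H; exists k => x; apply: leq_trans (H x) (Hk x). Qed.

Lemma leq_expl (a b k : nat) : a <= b -> a ^ k <= b ^ k.
Proof. by case: k => // k; rewrite leq_exp2r. Qed.

Lemma poly_const (X : Type) (mu : X -> nat) c : poly mu (fun=> c).
Proof.
exists c => x; apply: leq_trans (ltnW (ltn_expl c (ltnSn 1))) _; exact: leq_expl.
Qed.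

Lemma poly_id (X : Type) (mu : X -> nat) : poly mu mu.
Proof. by exists 1 => x; rewrite expn1; lia. Qed.

Lemma poly_mul (X : Type) (mu h h' : X -> nat) :
  poly mu h -> poly mu h' -> poly mu (fun x => h x * h' x).
Proof. by move=> [k Hk] [k' Hk']; exists (k + k') => x; rewrite expnD leq_mul. Qed.

Lemma poly_add (X : Type) (mu h h' : X -> nat) :
  poly mu h -> poly mu h' -> poly mu (fun x => h x + h' x).
Proof.
(* Two powers that are at least 1 have a sum of at most twice their product; the extra factor in the
   exponent pays for the 2. *)
move=> [k Hk] [k' Hk']; exists (k + k').+1 => x; rewrite expnS expnD.
have {Hk Hk'}[H1 H2] := (Hk x, Hk' x); set e := _ ^ k in H1 *; set e' := _ ^ k' in H2 *.
have : 0 < e by rewrite expn_gt0.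
have : 0 < e' by rewrite expn_gt0.
nia.
Qed.

Lemma poly_comp (X Y : Type) (mu : X -> nat) (nu h : Y -> nat) (f : X -> Y) :
  poly nu h -> poly mu (fun x => nu (f x)) -> poly mu (fun x => h (f x)).
Proof.
(* The inner bound is raised by 2 before taking the [k]-th power; as the base is at least 2, two
   more factors of it cover this. *)
move=> [k Hk] [j Hj]; exists (j.+2 * k) => x; apply: leq_trans (Hk _) _.
rewrite expnM; apply: leq_expl; rewrite -addn2 expnS expnS.
have := Hj x; set e := _ ^ j => H.
have : 0 < e by rewrite expn_gt0.
nia.
Qed.

(* Quantifying over [D] and [S], the contents below the argument, is what allows
   such programs to be run inside each other. *)
Definition FP (X A : Type) {HX : encodable X} {HA : encodable A} (mu : X -> nat)
    (f : X -> A) : Prop :=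
  poly mu esz /\ exists M T, poly mu T /\ forall x D S,
    exec M (st (code (enc x) ++ D) S) (T x) tt (st (code (enc (f x)) ++ D) S).

Lemma rep_exists s B : (forall i, size (stack s i) <= B) -> exists r, rep r s.
Proof.
move=> HB; exists (mkseq (fun j => [ffun i : 'I_5 => onth (rev (stack s i)) j]) B) => i j.
case: (ltnP j B) => Hj; first by rewrite nth_mkseq // ffunE.
by rewrite nth_default ?size_mkseq // ffunE onth_default // size_rev (leq_trans (HB i)).
Qed.

(** A run of n operations lengthens a stack by at most n, so the time bound also bounds the
    output. *)
Lemma FP_size (X A : Type) {HX : encodable X} {HA : encodable A} (mu : X -> nat) (f : X -> A) :
  FP mu f -> poly mu (fun x => esz (f x)).
Proof.
move=> [H0 [M [T [HT HM]]]]; apply: poly_le (poly_add H0 HT) _ => x.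
have [H] := HM x [::] [::].
have HB i : size (stack (st (code (enc x) ++ [::]) [::]) i) <= esz x.
  by case: i => [|[|[|[|[|i]]]]] ; rewrite /stack /= ?nth_nil ?cats0.
have [r Hr] := rep_exists HB.
by have [/(_ 0)] := H _ [::] r HB Hr; rewrite /stack /= cats0.
Qed.

Lemma FP_mu (X A : Type) {HX : encodable X} {HA : encodable A} (mu : X -> nat) (f : X -> A) :
  FP mu f -> poly mu esz.
Proof. by case. Qed.

Lemma FP_id (X : Type) {HX : encodable X} (mu : X -> nat) : poly mu esz -> FP mu id.
Proof.
by move=> H; split=> //; exists (pm_ret tt), (fun=> 1); split=> [|x D S]; [exact: poly_const | exact: exec_ret].
Qed.

(* Types whose values have the same tree are interchangeable. *)
Lemma FP_conv (X A B : Type) {HX : encodable X} {HA : encodable A} {HB : encodable B}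
    (mu : X -> nat) (f : X -> A) (g : X -> B) :
  (forall x, enc (f x) = enc (g x)) -> FP mu f -> FP mu g.
Proof.
move=> E [H0 [M [T [HT HM]]]]; split=> //; exists M, T; split=> // x D S.
by rewrite -E.
Qed.

Lemma FP_ext (X A : Type) {HX : encodable X} {HA : encodable A} (mu : X -> nat) (f g : X -> A) :
  f =1 g -> FP mu f -> FP mu g.
Proof. by move=> E; apply: FP_conv => x; rewrite E. Qed.

(** The outer function is measured by the size of its own argument, which [FP_size] bounds
    polynomially in [mu]. *)
Lemma FP_comp (X Y A : Type) {HX : encodable X} {HY : encodable Y} {HA : encodable A}
    (mu : X -> nat) (g : Y -> A) (f : X -> Y) :
  FP esz g -> FP mu f -> FP mu (fun x => g (f x)).
Proof.
move=> [_ [Mg [Tg [HTg Hg]]]] Hf; have Hs := FP_size Hf.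
case: Hf => H0 [Mf [Tf [HTf Hf]]]; split=> //.
exists (Mf ;; Mg), (fun x => Tf x + Tg (f x)); split.
  by apply: poly_add HTf (poly_comp HTg Hs).
by move=> x D S; apply: exec_bind (Hf _ _ _) (Hg _ _ _).
Qed.

Lemma FP_const (X A : Type) {HX : encodable X} {HA : encodable A} (mu : X -> nat) (v : A) :
  poly mu esz -> FP mu (fun=> v).
Proof.
move=> H0; split=> //.
exists (pm_drop ;; pm_puts (code (enc v))), (fun x => 13 * esz x + (esz v).+1); split.
  by apply: poly_add (poly_const _ _); apply: poly_mul H0; apply: poly_const.
by move=> x D S; apply: exec_bind (exec_drop _ _ _) (exec_puts _ _ _ _ _ _).
Qed.

Lemma FP_pair (X A B : Type) {HX : encodable X} {HA : encodable A} {HB : encodable B}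
    (mu : X -> nat) (f : X -> A) (g : X -> B) :
  FP mu f -> FP mu g -> FP mu (fun x => (f x, g x)).
Proof.
move=> [H0 [Mf [Tf [HTf Hf]]]] Hg'; have Hs := FP_size Hg'.
case: Hg' => _ [Mg [Tg [HTg Hg]]]; split=> //.
(* [g] runs first, so that after the swap the value of [f] lands on top; the pushed [true] is the
   node that joins the two values. *)
exists (pm_dup ;; Mg ;; pm_swap ;; Mf ;; pm_push rD true),
  (fun x => 25 * esz x + (Tg x + (14 * (esz (g x) + esz x) + (Tf x + 1)))); split.
  have P := poly_mul (poly_const mu _).
  apply: poly_add (P _ _ H0) (poly_add HTg (poly_add (P _ _ (poly_add Hs H0)) _)).
  exact: poly_add HTf (poly_const _ _).
move=> x D S; apply: exec_bind (exec_dup _ _ _) _; apply: exec_bind (Hg _ _ _) _.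
apply: exec_bind (exec_swap _ _ _ _) _; apply: exec_bind (Hf _ _ _) _.
by have := exec_push rD true (st (code (enc (f x)) ++ code (enc (g x)) ++ D) S); rewrite /= -catA.
Qed.

(** On trees, second projection, [behead] and predecessor are the same operation, and the value on
    [Leaf] matches their defaults on the empty list and on 0. *)
Definition tree_tail (t : tree) : tree := if t is Node _ b then b else Leaf.

Lemma FP_tail (X A B : Type) {HX : encodable X} {HA : encodable A} {HB : encodable B}
    (mu : X -> nat) (g : A -> B) (f : X -> A) :
  (forall a, enc (g a) = tree_tail (enc a)) -> FP mu f -> FP mu (fun x => g (f x)).
Proof.
move=> E; apply: FP_comp; split; first exact: poly_id.
exists (pm_bind (pm_pop rD) (fun o => if o is Some true then pm_drop else pm_push rD false)),
  (fun p => 1 + 13 * esz p); split.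
  by apply: poly_add (poly_const _ _) (poly_mul (poly_const _ _) (poly_id _)).
move=> x D S; apply: exec_bind (exec_pop rD _) _; rewrite E /esz.
case: (enc x) => [|a b] /=; last first.
  rewrite -catA; apply: exec_le _ (exec_drop _ _ _); rewrite leq_mul2l /sz /= size_cat; lia.
by apply: exec_le _ (exec_push rD _ _).
Qed.

Definition tree_head (t : tree) : tree := if t is Node a _ then a else Leaf.

Lemma FP_head_tree (X A B : Type) {HX : encodable X} {HA : encodable A} {HB : encodable B}
    (mu : X -> nat) (g : A -> B) (f : X -> A) :
  (forall a, enc (g a) = tree_head (enc a)) -> FP mu f -> FP mu (fun x => g (f x)).
Proof.
move=> E; apply: FP_comp; split; first exact: poly_id.
exists (pm_bind (pm_pop rD) (fun o => if o is Some true then pm_swap ;; pm_drop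
   else pm_push rD false)), (fun p => 1 + (14 * esz p + 13 * esz p)); split.
  apply: poly_add (poly_const _ _) (poly_add _ _);
    apply: poly_mul (poly_const _ _) (poly_id _).
move=> x D S; apply: exec_bind (exec_pop rD _) _; rewrite E /esz.
case: (enc x) => [|a b] /=; first by apply: exec_le _ (exec_push rD _ _).
rewrite -catA; apply: exec_bind.
  apply: exec_le _ (exec_swap _ _ _ _); rewrite leq_mul2l /esz /sz /= size_cat; exact: leqnSn.
apply: exec_le _ (exec_drop _ _ _); rewrite leq_mul2l /esz /sz /= size_cat; lia.
Qed.

Lemma FP_fst (X A B : Type) {HX : encodable X} {HA : encodable A} {HB : encodable B}
    (mu : X -> nat) (f : X -> A * B) : FP mu f -> FP mu (fun x => (f x).1).
Proof. exact: FP_head_tree. Qed.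

Lemma FP_snd (X A B : Type) {HX : encodable X} {HA : encodable A} {HB : encodable B}
    (mu : X -> nat) (f : X -> A * B) : FP mu f -> FP mu (fun x => (f x).2).
Proof. exact: FP_tail. Qed.

Lemma FP_behead (X A : Type) {HX : encodable X} {HA : encodable A}
    (mu : X -> nat) (f : X -> seq A) : FP mu f -> FP mu (fun x => behead (f x)).
Proof. by apply: FP_tail; case. Qed.

Lemma FP_pred (X : Type) {HX : encodable X} (mu : X -> nat) (f : X -> nat) :
  FP mu f -> FP mu (fun x => (f x).-1).
Proof. by apply: FP_tail; case. Qed.

Lemma FP_head (X : Type) {HX : encodable X} (mu : X -> nat) (f : X -> seq nat) :
  FP mu f -> FP mu (fun x => head 0 (f x)).
Proof. by apply: FP_head_tree; case. Qed.

Lemma FP_cons (X A : Type) {HX : encodable X} {HA : encodable A} (mu : X -> nat)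
    (f : X -> A) (g : X -> seq A) : FP mu f -> FP mu g -> FP mu (fun x => f x :: g x).
Proof. by move=> Hf Hg; apply: FP_conv (FP_pair Hf Hg). Qed.

Lemma FP_succ (X : Type) {HX : encodable X} (mu : X -> nat) (f : X -> nat) :
  FP mu f -> FP mu (fun x => (f x).+1).
Proof. by move=> Hf; apply: FP_conv (FP_pair (FP_const tt (FP_mu Hf)) Hf). Qed.

Lemma FP_nseq_tt (X : Type) {HX : encodable X} (mu : X -> nat) (f : X -> nat) :
  FP mu f -> FP mu (fun x => nseq (f x) tt).
Proof. by apply: FP_conv => x; elim: (f x) => //= n ->. Qed.

Lemma FP_if (X A : Type) {HX : encodable X} {HA : encodable A} (mu : X -> nat)
    (b : X -> bool) (f g : X -> A) :
  FP mu b -> FP mu f -> FP mu g -> FP mu (fun x => if b x then f x else g x).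
Proof.
move=> Hb [H0 [Mf [Tf [HTf Hf]]]] [_ [Mg [Tg [HTg Hg]]]].
have [_ [Mp [Tp [HTp Hp]]]] := FP_pair Hb (FP_id H0); split=> //.
(* The first pop removes the node of the pair, the second reads the boolean; the code of [true] has
   two further leaves to remove, that of [false] none. *)
exists (Mp ;; pm_pop rD ;; pm_bind (pm_pop rD) (fun o => if o is Some true
  then pm_pop rD ;; pm_pop rD ;; Mf else Mg)), (fun x => Tp x + (4 + (Tf x + Tg x))); split.
  exact: poly_add HTp (poly_add (poly_const _ _) (poly_add HTf HTg)).
move=> x D S; apply: exec_bind (Hp _ _ _) _.
case: (b x) => /=.
  apply: (exec_le (n := 1 + (1 + (1 + (1 + Tf x))))); first lia.
  by do 4!apply: exec_bind (exec_pop rD _) _; apply: Hf.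
apply: (exec_le (n := 1 + (1 + Tg x))); first lia.
by do 2!apply: exec_bind (exec_pop rD _) _; apply: Hg.
Qed.

Lemma FP_eq (X : Type) (A : eqType) {HX : encodable X} {HA : encodable A} (mu : X -> nat)
    (f g : X -> A) : FP mu f -> FP mu g -> FP mu (fun x => f x == g x).
Proof.
move=> Hf Hg; have [Sf Sg] := (FP_size Hf, FP_size Hg).
have [H0 [Mp [Tp [HTp Hp]]]] := FP_pair Hf Hg; split=> //.
exists (Mp ;; pm_pop rD ;; pm_eq), (fun x => Tp x + (1 + 30 * (esz (f x) + esz (g x)))); split.
  apply: poly_add HTp (poly_add (poly_const _ _) (poly_mul (poly_const _ _) (poly_add Sf Sg))).
move=> x D S; apply: exec_bind (Hp _ _ _) _; apply: exec_bind (exec_pop rD _) _.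
rewrite /= -catA; apply: exec_eq.
by apply: (iffP eqP) => [-> //|]; apply: enc_inj.
Qed.

Definition pm_fold (M : pm unit) : pm unit :=
  pm_loop (pm_bind (pm_pop rD) (fun o => if o is Some true then
    pm_swap ;; pm_save ;; pm_push rD true ;; M ;; pm_restore ;; pm_ret None
    else pm_ret (Some tt))).

(** Each round parks the tail of the list on [S] and pushes a node to form the pair [(a, b)] for
    [M]. The swap, the saving and the restoring cost at most [14 * Z] each, hence 42. [W] bounds [M]
    only on the accumulators that actually occur. *)
Lemma exec_fold (A B : Type) {HA : encodable A} {HB : encodable B} (F : B -> A -> B)
    (M : pm unit) (T : A * B -> nat) l b D S W Z :
  (forall a b D S, exec M (st (code (enc (a, b)) ++ D) S) (T (a, b)) tt
     (st (code (enc (F b a)) ++ D) S)) ->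
  (forall l1 a l2, l = l1 ++ a :: l2 -> T (a, foldl F b l1) <= W) -> esz l <= Z ->
  exec (pm_fold M) (st (code (enc l) ++ code (enc b) ++ D) S)
    (size l * (42 * Z + 3 + W) + 2) tt (st (code (enc (foldl F b l)) ++ D) S).
Proof.
move=> HM; elim: l b => [|a l IH] b HW HZ.
  apply: exec_loop_exit; apply: (exec_bind (n := 1) (n' := 1) (exec_pop rD _)).
  exact: exec_ret.
have HZ' : esz a + esz l < Z by move: HZ; rewrite /esz /sz /= size_cat.
rewrite /= mulSn -addnA; apply: exec_loop_next; last first.
  apply: IH; first by move=> l1 a' l2 E; apply: (HW (a :: l1) a' l2); rewrite E.
  by apply: leq_trans (ltnW HZ'); apply: leq_addl.
have H1 := HW [::] a l (erefl _); rewrite /= in H1.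
apply: (exec_le (n := 1 + (14 * (esz a + esz l) + (14 * esz l + (1 + (T (a, b) + (14 * esz l + 1))))))).
  lia.
apply: exec_bind (exec_pop rD _) _; rewrite /= -catA.
apply: exec_bind (exec_swap _ _ _ _) _; apply: exec_bind (exec_save _ _ _) _.
apply: exec_bind (exec_push rD true _) _ => /=.
apply: exec_bind; first by have := HM a b D (code (enc l) ++ S); rewrite /= -catA; apply.
apply: exec_bind (exec_restore _ _ _) _; exact: exec_ret.
Qed.

Lemma esz_gt0 (A : Type) {HA : encodable A} (x : A) : 0 < esz x.
Proof. exact: sz_gt0. Qed.

Lemma esz_cat (A : Type) {HA : encodable A} (l1 l2 : seq A) :
  esz (l1 ++ l2) = esz l1 + (esz l2).-1.
Proof.
rewrite /esz /=; elim: l1 => [|a l IH] /=; first by rewrite add1n prednK // sz_gt0.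
by move: IH; rewrite /sz /= !size_cat => ->; rewrite addnA.
Qed.

Lemma esz_cons (A : Type) {HA : encodable A} (a : A) (l : seq A) :
  esz (a :: l) = (esz a + esz l).+1.
Proof. by rewrite /esz /sz /= size_cat. Qed.

Lemma esz_pair (A B : Type) {HA : encodable A} {HB : encodable B} (p : A * B) :
  esz p = (esz p.1 + esz p.2).+1.
Proof. by rewrite /esz /sz /= size_cat. Qed.

Lemma size_esz (A : Type) {HA : encodable A} (l : seq A) : size l <= esz l.
Proof. by elim: l => // a l IH; rewrite esz_cons /=; lia. Qed.

(** The bound [h] on every partial result is essential to the argument: it keeps each round
    polynomial in [mu], while the number of rounds is at most the size of the list. *)
Lemma FP_foldl_closed (X A B : Type) {HX : encodable X} {HA : encodable A} {HB : encodable B}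
    (mu h : X -> nat) (F : B -> A -> B) (l : X -> seq A) (b : X -> B) :
  FP esz (fun q : A * B => F q.2 q.1) -> FP mu l -> FP mu b -> poly mu h ->
  (forall x l1 l2, l x = l1 ++ l2 -> esz (foldl F (b x) l1) <= h x) ->
  FP mu (fun x => foldl F (b x) (l x)).
Proof.
move=> [_ [M [T [[k HT] HM]]]] Hl Hb Hh Hacc; have Sl := FP_size Hl.
have [H0 [Mp [Tp [HTp Hp]]]] := FP_pair Hl Hb; split=> //.
exists (Mp ;; pm_pop rD ;; pm_fold M), (fun x => Tp x + (1 +
  (esz (l x) * (42 * esz (l x) + 3 + (esz (l x) + h x + 3) ^ k) + 2))); split.
  apply: poly_add HTp (poly_add (poly_const _ _) (poly_add (poly_mul Sl _) (poly_const _ _))).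
  apply: poly_add; first exact: poly_add (poly_mul (poly_const _ _) Sl) (poly_const _ _).
  apply: (poly_comp (nu := id) (h := fun y => y ^ k) (f := fun x => esz (l x) + h x + 3)).
    by exists k => y; apply: leq_expl; lia.
  exact: poly_add (poly_add Sl Hh) (poly_const _ _).
move=> x D S; apply: exec_bind (Hp _ _ _) _; apply: exec_bind (exec_pop rD _) _.
rewrite /= -catA; apply: exec_le; last apply: (@exec_fold _ _ _ _ F M T (l x) (b x) D S
  ((esz (l x) + h x + 3) ^ k) (esz (l x))) => //.
- by rewrite leq_add2r leq_mul2r size_esz orbT.
move=> l1 a l2 E; apply: leq_trans (HT _) _; apply: leq_expl.
rewrite esz_pair /=; have := Hacc x l1 (a :: l2) E.
have : esz a + 1 <= esz (l x).
  have H2 : 0 < esz l2 by apply: esz_gt0.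
  by rewrite E esz_cat esz_cons /=; lia.
lia.
Qed.

(** A step that depends on [x] is made closed by carrying [x] along in the accumulator. *)
Lemma FP_foldl (X A B : Type) {HX : encodable X} {HA : encodable A} {HB : encodable B}
    (mu h : X -> nat) (F : X -> B -> A -> B) (l : X -> seq A) (b : X -> B) :
  FP esz (fun q : A * (X * B) => F q.2.1 q.2.2 q.1) -> FP mu l -> FP mu b -> poly mu h ->
  (forall x l1 l2, l x = l1 ++ l2 -> esz (foldl (F x) (b x) l1) <= h x) ->
  FP mu (fun x => foldl (F x) (b x) (l x)).
Proof.
move=> HF Hl Hb Hh Hacc; have H0 := FP_mu Hl.
pose G (p : X * B) (a : A) := (p.1, F p.1 p.2 a).
have E x l' y : foldl G (x, y) l' = (x, foldl (F x) y l') by elim: l' y => //= a l' IH y; apply: (IH (F x y a)).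
apply: (FP_ext (f := fun x => (foldl G (x, b x) (l x)).2)) => [x|]; first by rewrite E.
apply: FP_snd; apply: (FP_foldl_closed (h := fun x => esz x + h x + 1)) => //.
- have Hp : FP esz (fun q : A * (X * B) => q) by apply: FP_id; apply: poly_id.
  by apply: FP_pair HF; apply: FP_fst; apply: FP_snd.
- by apply: FP_pair Hb; apply: FP_id.
- exact: poly_add (poly_add H0 Hh) (poly_const _ _).
- by move=> x l1 l2 El; rewrite E esz_pair /=; have := Hacc x l1 l2 El; lia.
Qed.

(** * Lists and numbers *)

Ltac fp := repeat first
  [ eassumption
  | exact: poly_id
  | lazymatch goal with
    | |- FP _ (fun x => x) => apply: FP_id
    | |- FP ?mu (@fst ?A ?B) => change (FP mu (fun x : A * B => x.1))
    | |- FP ?mu (@snd ?A ?B) => change (FP mu (fun x : A * B => x.2))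
    | |- FP ?mu S => change (FP mu (fun x => x.+1))
    | |- FP ?mu predn => change (FP mu (fun x => x.-1))
    | |- FP _ (fun x => (_, _)) => apply: FP_pair
    | |- FP _ (fun x => fst _) => apply: FP_fst
    | |- FP _ (fun x => snd _) => apply: FP_snd
    | |- FP _ (fun x => cons _ _) => apply: FP_cons
    | |- FP _ (fun x => S _) => apply: FP_succ
    | |- FP _ (fun x => predn _) => apply: FP_pred
    | |- FP _ (fun x => behead _) => apply: FP_behead
    | |- FP _ (fun x => head 0 _) => apply: FP_head
    | |- FP _ (fun x => nseq _ tt) => apply: FP_nseq_tt
    | |- FP _ (fun x => if _ then _ else _) => apply: FP_if
    | |- FP _ (fun x => eq_op _ _) => apply: FP_eq
    end
  | apply: FP_const ].

Lemma esz_nat (n : nat) : esz n = n.*2.+1.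
Proof. by rewrite /esz /=; elim: n => // n IH; rewrite /sz /= in IH *; rewrite IH doubleS. Qed.

Lemma esz_bool (b : bool) : esz b <= 3.
Proof. by case: b. Qed.

Lemma esz_nil (A : Type) {HA : encodable A} : esz ([::] : seq A) = 1.
Proof. by []. Qed.

Lemma esz_rev (A : Type) {HA : encodable A} (l : seq A) : esz (rev l) = esz l.
Proof.
elim: l => // a l IH; rewrite rev_cons -cats1 esz_cat IH !esz_cons esz_nil /=.
by have H : 0 < esz l by [apply: esz_gt0]; lia.
Qed.

Lemma esz_catl (A : Type) {HA : encodable A} (l1 l2 : seq A) : esz l1 <= esz (l1 ++ l2).
Proof. by rewrite esz_cat leq_addr. Qed.

Lemma FP_neg (X : Type) {HX : encodable X} (mu : X -> nat) (b : X -> bool) :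
  FP mu b -> FP mu (fun x => ~~ b x).
Proof.
move=> Hb; have H0 := FP_mu Hb.
by apply: (FP_ext (f := fun x => if b x then false else true)) => [x|]; [case: (b x) | fp].
Qed.

Lemma FP_or (X : Type) {HX : encodable X} (mu : X -> nat) (b c : X -> bool) :
  FP mu b -> FP mu c -> FP mu (fun x => b x || c x).
Proof.
move=> Hb Hc; have H0 := FP_mu Hb.
by apply: (FP_ext (f := fun x => if b x then true else c x)) => [x|]; [case: (b x) | fp].
Qed.

Lemma FP_and (X : Type) {HX : encodable X} (mu : X -> nat) (b c : X -> bool) :
  FP mu b -> FP mu c -> FP mu (fun x => b x && c x).
Proof.
move=> Hb Hc; have H0 := FP_mu Hb.
by apply: (FP_ext (f := fun x => if b x then c x else false)) => [x|]; [case: (b x) | fp].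
Qed.

Lemma FP_rev (X A : Type) {HX : encodable X} {HA : encodable A} (mu : X -> nat)
    (l : X -> seq A) : FP mu l -> FP mu (fun x => rev (l x)).
Proof.
move=> Hl; have H0 := FP_mu Hl; have Hs := FP_size Hl.
have E (s : seq A) acc : foldl (fun acc a => a :: acc) acc s = rev s ++ acc.
  by elim: s acc => //= a s IH acc; rewrite IH rev_cons cat_rcons.
apply: (FP_ext (f := fun x => foldl (fun acc a => a :: acc) [::] (l x))).
  by move=> x; rewrite E cats0.
apply: FP_foldl_closed Hs _ => //; fp => x l1 l2 ->.
by rewrite E cats0 esz_rev esz_catl.
Qed.

Lemma esz_map_le (A B : Type) {HA : encodable A} {HB : encodable B} (F : A -> B) l W :
  (forall l1 a l2, l = l1 ++ a :: l2 -> esz (F a) <= W) ->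
  esz (map F l) <= size l * W.+1 + 1.
Proof.
elim: l => [|a l IH] H //=; rewrite esz_cons.
have := IH (fun l1 a' l2 E => H (a :: l1) a' l2 (congr1 (cons a) E)).
by have := H [::] a l erefl; lia.
Qed.

Lemma FP_map (X A B : Type) {HX : encodable X} {HA : encodable A} {HB : encodable B}
    (mu : X -> nat) (F : X -> A -> B) (l : X -> seq A) :
  FP esz (fun q : X * A => F q.1 q.2) -> FP mu l -> FP mu (fun x => map (F x) (l x)).
Proof.
move=> HF Hl; have H0 := FP_mu Hl; have Hs := FP_size Hl.
have E x (s : seq A) acc : foldl (fun acc a => F x a :: acc) acc s = rev (map (F x) s) ++ acc.
  by elim: s acc => //= a s IH acc; rewrite IH rev_cons cat_rcons.
have [k Hk] := FP_size HF.
apply: (FP_ext (f := fun x => rev (foldl (fun acc a => F x a :: acc) [::] (l x)))).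
  by move=> x; rewrite E cats0 revK.
(* [FP_size] bounds [F x a] through the size of [(x, a)], and [a] is smaller than the list, so one
   bound serves all images. *)
apply: FP_rev; apply: (FP_foldl
  (h := fun x => esz (l x) * ((esz x + esz (l x) + 3) ^ k).+1 + 1)) => //; fp.
- apply: (FP_comp (g := fun q : X * A => F q.1 q.2)
    (f := fun q : A * (X * seq B) => (q.2.1, q.1))) => //; fp.
- apply: poly_add (poly_mul Hs _) (poly_const _ _).
  apply: (poly_comp (nu := id) (h := fun y => (y ^ k).+1) (f := fun x => esz x + esz (l x) + 3)).
    by apply: (poly_le (h' := fun y => y ^ k + 1)) => [|y];
      [apply: poly_add (poly_const _ _); exists k => y; apply: leq_expl; lia | rewrite addn1].
  exact: poly_add (poly_add H0 Hs) (poly_const _ _).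
move=> x l1 l2 El; rewrite E cats0 esz_rev.
apply: leq_trans (esz_map_le (W := (esz x + esz (l x) + 3) ^ k) _) _.
  move=> l3 a l4 E1; apply: leq_trans (Hk (x, a)) _; apply: leq_expl.
  rewrite esz_pair El E1 -catA esz_cat cat_cons esz_cons esz_cat /=.
  by have H : 0 < esz l4 by [apply: esz_gt0]; lia.
rewrite leq_add2r leq_mul2r; apply/orP; right; apply: leq_trans (size_esz _) _.
by rewrite El esz_catl.
Qed.

Lemma esz_filter (A : Type) {HA : encodable A} (p : pred A) l : esz (filter p l) <= esz l.
Proof. by elim: l => //= a l IH; case: (p a); rewrite !esz_cons; lia. Qed.

Lemma FP_filter (X A : Type) {HX : encodable X} {HA : encodable A}
    (mu : X -> nat) (P : X -> pred A) (l : X -> seq A) :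
  FP esz (fun q : X * A => P q.1 q.2) -> FP mu l -> FP mu (fun x => filter (P x) (l x)).
Proof.
move=> HP Hl; have H0 := FP_mu Hl; have Hs := FP_size Hl.
have E x (s : seq A) acc : foldl (fun acc a => if P x a then a :: acc else acc) acc s
    = rev (filter (P x) s) ++ acc.
  by elim: s acc => //= a s IH acc; rewrite IH; case: (P x a); rewrite ?rev_cons ?cat_rcons.
apply: (FP_ext (f := fun x => rev (foldl (fun acc a => if P x a then a :: acc else acc) [::] (l x)))).
  by move=> x; rewrite E cats0 revK.
apply: FP_rev; apply: FP_foldl Hs _; fp.
  apply: (FP_comp (g := fun q : X * A => P q.1 q.2)
    (f := fun q : A * (X * seq A) => (q.2.1, q.1))) => //; fp.
move=> x l1 l2 El; rewrite E cats0 esz_rev El.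
exact: leq_trans (esz_filter _ _) (esz_catl _ _).
Qed.

Lemma FP_has (X A : Type) {HX : encodable X} {HA : encodable A}
    (mu : X -> nat) (P : X -> pred A) (l : X -> seq A) :
  FP esz (fun q : X * A => P q.1 q.2) -> FP mu l -> FP mu (fun x => has (P x) (l x)).
Proof.
move=> HP Hl; have H0 := FP_mu Hl.
have E x (s : seq A) acc : foldl (fun acc a => acc || P x a) acc s = acc || has (P x) s.
  by elim: s acc => [|a s IH] acc /=; rewrite ?orbF // IH orbA.
apply: (FP_ext (f := fun x => foldl (fun acc a => acc || P x a) false (l x))).
  by move=> x; rewrite E.
apply: FP_foldl (poly_const _ 3) _; fp; last by move=> *; apply: esz_bool.
apply: FP_or; fp; apply: (FP_comp (g := fun q : X * A => P q.1 q.2)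
  (f := fun q : A * (X * bool) => (q.2.1, q.1))) => //; fp.
Qed.

Lemma FP_all (X A : Type) {HX : encodable X} {HA : encodable A}
    (mu : X -> nat) (P : X -> pred A) (l : X -> seq A) :
  FP esz (fun q : X * A => P q.1 q.2) -> FP mu l -> FP mu (fun x => all (P x) (l x)).
Proof.
move=> HP Hl; apply: (FP_ext (f := fun x => ~~ has (fun a => ~~ P x a) (l x))).
  by move=> x; rewrite -all_predC; apply: eq_all => a; rewrite /= negbK.
by apply: FP_neg; apply: FP_has Hl; apply: FP_neg.
Qed.

Lemma FP_mem (X : Type) (A : eqType) {HX : encodable X} {HA : encodable A}
    (mu : X -> nat) (f : X -> A) (l : X -> seq A) :
  FP mu f -> FP mu l -> FP mu (fun x => f x \in l x).
Proof.
move=> Hf Hl; apply: (FP_ext (f := fun x => has (pred1 (f x, l x).1) (f x, l x).2)).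
  by move=> x; rewrite has_pred1.
apply: (FP_comp (g := fun p : A * seq A => has (pred1 p.1) p.2)); fp.
by apply: FP_has; fp; rewrite /=; fp.
Qed.

Lemma FP_count (X A : Type) {HX : encodable X} {HA : encodable A}
    (mu : X -> nat) (P : X -> pred A) (l : X -> seq A) :
  FP esz (fun q : X * A => P q.1 q.2) -> FP mu l -> FP mu (fun x => count (P x) (l x)).
Proof.
move=> HP Hl; have H0 := FP_mu Hl; have Hs := FP_size Hl.
have E x (s : seq A) n : foldl (fun n a => if P x a then n.+1 else n) n s = count (P x) s + n.
  by elim: s n => [|a s IH] n //=; rewrite IH; case: (P x a); rewrite ?addnS.
apply: (FP_ext (f := fun x => foldl (fun n a => if P x a then n.+1 else n) 0 (l x))).
  by move=> x; rewrite E addn0.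
apply: (FP_foldl (h := fun x => 2 * esz (l x) + 1)); fp.
- apply: (FP_comp (g := fun q : X * A => P q.1 q.2)
    (f := fun q : A * (X * nat) => (q.2.1, q.1))) => //; fp.
- exact: poly_add (poly_mul (poly_const _ _) Hs) (poly_const _ _).
move=> x l1 l2 ->; rewrite E addn0 esz_nat esz_cat.
have H1 : size l1 <= esz l1 by apply: size_esz.
by have := count_size (P x) l1; lia.
Qed.

Lemma FP_iter (X A : Type) {HX : encodable X} {HA : encodable A} (mu h : X -> nat)
    (F : A -> A) (n : X -> nat) (a : X -> A) :
  FP esz F -> FP mu n -> FP mu a -> poly mu h ->
  (forall x i, i <= n x -> esz (iter i F (a x)) <= h x) ->
  FP mu (fun x => iter (n x) F (a x)).
Proof.
move=> HF Hn Ha Hh H; have E (s : seq unit) y : foldl (fun y _ => F y) y s = iter (size s) F y.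
  by elim: s y => //= _ s IH y; rewrite IH -iterSr.
apply: (FP_ext (f := fun x => foldl (fun y _ => F y) (a x) (nseq (n x) tt))).
  by move=> x; rewrite E size_nseq.
apply: FP_foldl_closed Hh _; fp.
  apply: FP_comp HF _; fp.
move=> x l1 l2 /(congr1 size); rewrite size_nseq size_cat E => En.
by apply: H; rewrite En leq_addr.
Qed.

Lemma FP_add (X : Type) {HX : encodable X} (mu : X -> nat) (f g : X -> nat) :
  FP mu f -> FP mu g -> FP mu (fun x => f x + g x).
Proof.
move=> Hf Hg; apply: (FP_ext (f := fun x => iter (f x) succn (g x))).
  by move=> x; rewrite iter_succn addnC.
apply: (FP_iter (h := fun x => 2 * esz (f x) + esz (g x))); fp.
  by apply: poly_add; [apply: poly_mul (poly_const _ _) _|]; apply: FP_size.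
by move=> x i Hi; rewrite iter_succn !esz_nat; lia.
Qed.

Lemma FP_sub (X : Type) {HX : encodable X} (mu : X -> nat) (f g : X -> nat) :
  FP mu f -> FP mu g -> FP mu (fun x => f x - g x).
Proof.
move=> Hf Hg; have E m n : iter m predn n = n - m.
  by elim: m => [|m IH]; rewrite ?subn0 //= IH subnS.
apply: (FP_ext (f := fun x => iter (g x) predn (f x))); first by move=> x; rewrite E.
apply: (FP_iter (h := fun x => esz (f x))); fp; first exact: FP_size.
by move=> x i Hi; rewrite E !esz_nat; lia.
Qed.

Lemma FP_leq (X : Type) {HX : encodable X} (mu : X -> nat) (f g : X -> nat) :
  FP mu f -> FP mu g -> FP mu (fun x => f x <= g x).
Proof. by move=> Hf Hg; apply: FP_eq (FP_sub Hf Hg) (FP_const 0 (FP_mu Hf)). Qed.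

Lemma FP_sumn (X : Type) {HX : encodable X} (mu : X -> nat) (l : X -> seq nat) :
  FP mu l -> FP mu (fun x => sumn (l x)).
Proof.
move=> Hl; have H0 := FP_mu Hl.
apply: (FP_ext (f := fun x => foldl (fun n a => n + a) 0 (l x))).
  move=> x; rewrite -sumn_rev; have E s n : foldl (fun n a => n + a) n s = sumn s + n.
    by elim: s n => //= a s IH n; rewrite IH; lia.
  by rewrite E addn0 sumn_rev.
apply: (FP_foldl_closed (FP_add _ _)) (FP_size Hl) _; fp.
move=> x l1 l2 ->; rewrite esz_cat.
have : esz (foldl (fun n a => n + a) 0 l1) <= esz l1.
  have E s n : esz (foldl (fun n a => n + a) n s) < esz s + n.*2.+1.
    elim: s n => [|a s IH] n /=; first by rewrite esz_nat esz_nil.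
    by rewrite esz_cons; have := IH (n + a); rewrite !esz_nat; lia.
  by have := E l1 0; rewrite double0 addn1 ltnS.
by move/leq_trans; apply; apply: leq_addr.
Qed.

(** The induction on [c] builds a separate program for each constant; fixing [r] in advance makes
    this enough. *)
Lemma FP_mulc (X : Type) {HX : encodable X} (mu : X -> nat) c (f : X -> nat) :
  FP mu f -> FP mu (fun x => c * f x).
Proof.
move=> Hf; have H0 := FP_mu Hf; elim: c => [|c IH]; first by fp.
by apply: (FP_ext (f := fun x => f x + c * f x)) => //; apply: FP_add.
Qed.

Lemma FP_take (X : Type) {HX : encodable X} (mu : X -> nat) r (l : X -> seq nat) :
  FP mu l -> FP mu (fun x => take r (l x)).
Proof.
elim: r l => [|r IH] l Hl; have H0 := FP_mu Hl.
  by apply: (FP_ext (f := fun x => [::])); [move=> x; rewrite take0 | fp].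
apply: (FP_ext (f := fun x => if l x == [::] then [::] else head 0 (l x) :: take r (behead (l x)))).
  by move=> x; case: (l x).
by fp; apply: IH; fp.
Qed.

Lemma FP_iota (X : Type) {HX : encodable X} (mu : X -> nat) (m : X -> nat) :
  FP mu m -> FP mu (fun x => iota 0 (m x)).
Proof.
move=> Hm; have H0 := FP_mu Hm.
pose F (p : nat * seq nat) := (p.1.+1, p.1 :: p.2).
have E n : iter n F (0, [::]) = (n, rev (iota 0 n)).
  elim: n => // n IH; rewrite iterS IH /F.
  by have -> : iota 0 n.+1 = iota 0 n ++ [:: n] by [rewrite -addn1 iotaD]; rewrite rev_cat.
apply: (FP_ext (f := fun x => rev (iter (m x) F (0, [::])).2)).
  by move=> x; rewrite E revK.
apply: FP_rev; apply: FP_snd.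
apply: (FP_iter (h := fun x => esz (m x) * (esz (m x) + 1) + esz (m x) + 2)); rewrite /F; fp.
  have P := FP_size Hm.
  exact: poly_add (poly_add (poly_mul P (poly_add P (poly_const _ _))) P) (poly_const _ _).
move=> x i Hi; rewrite E esz_pair esz_rev /=.
have H : esz (iota 0 i) <= size (iota 0 i) * (esz i).+1 + 1.
  rewrite -{1}[iota 0 i]map_id; apply: esz_map_le => l1 a l2 El.
  have : a \in iota 0 i by rewrite El mem_cat mem_head orbT.
  by rewrite mem_iota !esz_nat; lia.
by move: H; rewrite size_iota !esz_nat; nia.
Qed.

Ltac fp_lists := repeat (cbv beta; first
  [ progress fp
  | lazymatch goal with
    | |- FP _ (fun x => ~~ _) => apply: FP_neg
    | |- FP _ (fun x => _ || _) => apply: FP_or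
    | |- FP _ (fun x => _ && _) => apply: FP_and
    | |- FP _ (fun x => rev _) => apply: FP_rev
    | |- FP _ (fun x => map _ _) => apply: FP_map
    | |- FP _ (fun x => filter _ _) => apply: FP_filter
    | |- FP _ (fun x => has _ _) => apply: FP_has
    | |- FP _ (fun x => all _ _) => apply: FP_all
    | |- FP _ (fun x => count _ _) => apply: FP_count
    | |- FP _ (fun x => in_mem _ _) => apply: FP_mem
    | |- FP _ (fun x => leq _ _) => apply: FP_leq
    | |- FP _ (fun x => addn _ _) => apply: FP_add
    | |- FP _ (fun x => subn _ _) => apply: FP_sub
    | |- FP _ (fun x => muln _ _) => apply: FP_mulc
    | |- FP _ (fun x => sumn _) => apply: FP_sumn
    | |- FP _ (fun x => take _ _) => apply: FP_take
    | |- FP _ (fun x => iota 0 _) => apply: FP_iota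
    end ]).

(** * The dynamic program *)

Lemma FP_weaken (X A : Type) {HX : encodable X} {HA : encodable A} (nu mu : X -> nat)
    (f : X -> A) : (forall x, nu x <= mu x) -> FP nu f -> FP mu f.
Proof.
move=> H [H0 [M [T [HT HM]]]].
have W h : poly nu h -> poly mu h.
  by move=> [k Hk]; exists k => x; apply: leq_trans (Hk x) _; apply: leq_expl; rewrite !ltnS.
by split; [apply: W | exists M, T; split; [apply: W|]].
Qed.

(** Each list element pays for the growth that it causes, so partial results stay linear in the list
    and only a single step has to be inspected. *)
Lemma FP_foldl_linear (X A B : Type) {HX : encodable X} {HA : encodable A} {HB : encodable B}
    (mu : X -> nat) (c : nat) (F : X -> B -> A -> B) (l : X -> seq A) (b : X -> B) :
  FP esz (fun q : A * (X * B) => F q.2.1 q.2.2 q.1) -> FP mu l -> FP mu b ->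
  (forall x b a, esz (F x b a) <= esz b + c * (esz a).+1) ->
  FP mu (fun x => foldl (F x) (b x) (l x)).
Proof.
move=> HF Hl Hb Hc; apply: (FP_foldl (h := fun x => esz (b x) + c * esz (l x))) => //.
  by apply: poly_add (FP_size Hb) (poly_mul (poly_const _ _) (FP_size Hl)).
move=> x l1 l2 E; apply: (@leq_trans (esz (b x) + c * esz l1)).
  elim: l1 (b x) {E} => [|a l1 IH] b' /=; first by rewrite leq_addr.
  apply: leq_trans (IH _) _; rewrite esz_cons; have := Hc x b' a; lia.
by rewrite leq_add2l leq_mul2l E esz_catl orbT.
Qed.

(** * Decoding the input word *)

Definition number_step (q : nat * seq nat) (b : bool) : nat * seq nat :=
  if b then (q.1.+1, q.2) else (0, q.1 :: q.2).

(** An encoded instance is a plain concatenation of unary numbers, so they can be split off before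
    any structure is recognised. *)
Definition numbers (w : seq bool) : seq nat := rev (foldl number_step (0, [::]) w).2.

Lemma FP_numbers (X : Type) {HX : encodable X} (mu : X -> nat) (w : X -> seq bool) :
  FP mu w -> FP mu (fun x => numbers (w x)).
Proof.
move=> Hw; have H0 := FP_mu Hw; apply: FP_rev; apply: FP_snd.
apply: (FP_foldl_linear (c := 2) (F := fun=> number_step)); rewrite /number_step; fp.
move=> _ [n s] b; rewrite !esz_pair !esz_nat /=.
have : 0 < esz b by apply: esz_gt0.
by case: b => /=; rewrite ?esz_cons ?esz_nat; lia.
Qed.

Lemma numbersK (s : seq nat) : numbers (flatten (map enc_nat s)) = s.
Proof.
rewrite -[RHS]revK; congr rev; rewrite -[rev s]cats0.
elim: s [::] => //= n s IH acc; rewrite foldl_cat /enc_nat -cats1 foldl_cat /=.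
have E k : foldl number_step (k, acc) (nseq n true) = (k + n, acc).
  by elim: n k => [|n IHn] k /=; rewrite ?addn0 // IHn /= addnS.
by rewrite E IH rev_cons cat_rcons.
Qed.

(* State: length still to be read of the current vote (0 before a header), its
   entries so far reversed, and the completed votes reversed. *)
Definition chunk_step (q : nat * (seq nat * seq (seq nat))) (x : nat) :=
  if q.1 == 0 then (x, ([::], q.2.2))
  else if q.1 == 1 then (0, ([::], rev (x :: q.2.1) :: q.2.2))
  else (q.1.-1, (x :: q.2.1, q.2.2)).

Definition chunks (s : seq nat) : seq (seq nat) :=
  rev (foldl chunk_step (0, ([::], [::])) s).2.2.

Lemma FP_chunks (X : Type) {HX : encodable X} (mu : X -> nat) (s : X -> seq nat) :
  FP mu s -> FP mu (fun x => chunks (s x)).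
Proof.
move=> Hs; have H0 := FP_mu Hs; apply: FP_rev; do 2!apply: FP_snd.
apply: (FP_foldl_linear (c := 4) (F := fun=> chunk_step)); rewrite /chunk_step; fp.
  by apply: FP_rev; fp.
move=> _ [k [u vs]] x /=; case: eqP => [->|k0]; last case: eqP => [->|k1].
- by rewrite !esz_pair !esz_nat /= esz_nil; have := esz_gt0 u; lia.
- by rewrite !esz_pair !esz_cons esz_rev esz_cons !esz_nat /= esz_nil; lia.
- by rewrite !esz_pair !esz_cons !esz_nat /=; lia.
Qed.

(** Nonemptiness matters: a header 0 leaves the state waiting for a header, so an empty vote would
    be lost. *)
Lemma chunksK (vs : seq (seq nat)) : all (fun v => 0 < size v) vs ->
  chunks (flatten [seq size v :: v | v <- vs]) = vs.
Proof.
move=> H; rewrite /chunks -[RHS]revK; congr rev; rewrite -[rev vs]cats0.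
elim: vs ([::] : seq (seq nat)) H => //= v vs IH acc /andP[Hv Hvs]; rewrite foldl_cat.
have E u (w : seq nat) : 0 < size w ->
    foldl chunk_step (size w, (u, acc)) w = (0, ([::], (rev u ++ w) :: acc)).
  elim: w u => // x [|y w] IHw u _; first by rewrite /= /chunk_step /= rev_cons cats1.
  transitivity (foldl chunk_step (size (y :: w), (x :: u, acc)) (y :: w)) => //.
  by rewrite IHw // rev_cons cat_rcons.
by rewrite E // IH // rev_cons cat_rcons.
Qed.

(* Number of candidates, distinguished candidate, budget, votes. *)
Definition instance : Type := (nat * (nat * (nat * seq (seq nat))))%type.

(** * Demands and reachable states *)

Definition approved (r : nat) (I : instance) : seq (seq nat) := [seq take r v | v <- I.2.2.2].

Definition approvals (c : nat) (ts : seq (seq nat)) : nat := count (fun t => c \in t) ts.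

Definition tops (r : nat) (I : instance) : seq (seq nat) :=
  [seq t <- approved r I | I.2.1 \notin t].

(** Truncated subtraction gives 0 to a rival that is already beaten. *)
Definition demand (r : nat) (I : instance) (c : nat) : nat :=
  if c == I.2.1 then 0 else
  (approvals c (approved r I)).+1 - approvals I.2.1 (approved r I).

Definition demands (r : nat) (I : instance) : seq (nat * nat) :=
  [seq (c, demand r I c) | c <- iota 0 I.1].

Definition affordable (r : nat) (I : instance) : bool :=
  sumn [seq e.2 | e <- demands r I] <= r * I.2.2.1.

(* Remaining budget, and the remaining demand of each candidate. *)
Definition state : Type := (nat * seq (nat * nat))%type.

Definition delete_vote (t : seq nat) (s : state) : state :=
  (s.1.-1, [seq (e.1, if e.1 \in t then e.2.-1 else e.2) | e <- s.2]).

Definition insert (S : seq state) (s : state) : seq state := if s \in S then S else s :: S.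

(** The fold starts from [S], which keeps the choice of sparing [t]; only states with budget left
    get a successor. *)
Definition dp_step (S : seq state) (t : seq nat) : seq state :=
  foldl (fun S' s => insert S' (delete_vote t s)) S [seq s <- S | s.1 != 0].

(** The closure lemmas ask for a bound on every input, including unaffordable ones; emptying the
    demands there makes [start_bound] unconditional. *)
Definition start (r : nat) (I : instance) : state :=
  (I.2.2.1, if affordable r I then demands r I else [::]).

Definition satisfied (s : state) : bool := all (fun e => e.2 == 0) s.2.

Definition decide_dv (r : nat) (I : instance) : bool :=
  affordable r I && has satisfied (foldl dp_step [:: start r I] (tops r I)).

(** Four numbers precede the votes, the fourth being their count; hence four [behead]s. *)
Definition parse (w : seq bool) : instance :=
  let s := numbers w in
  (head 0 s, (head 0 (behead s), (head 0 (behead (behead s)),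
    chunks (behead (behead (behead (behead s))))))).

Lemma FP_parse (X : Type) {HX : encodable X} (mu : X -> nat) (w : X -> seq bool) :
  FP mu w -> FP mu (fun x => parse (w x)).
Proof.
move=> Hw; have H := FP_numbers Hw; rewrite /parse; fp.
by apply: FP_chunks; fp.
Qed.

Lemma FP_approved (X : Type) {HX : encodable X} (mu : X -> nat) r (I : X -> instance) :
  FP mu I -> FP mu (fun x => approved r (I x)).
Proof. by move=> HI; rewrite /approved; fp_lists. Qed.

Lemma FP_tops (X : Type) {HX : encodable X} (mu : X -> nat) r (I : X -> instance) :
  FP mu I -> FP mu (fun x => tops r (I x)).
Proof.
move=> HI; apply: (FP_comp (g := tops r)) => //; rewrite /tops; fp_lists.
by apply: FP_approved; fp.
Qed.

Lemma FP_demands (X : Type) {HX : encodable X} (mu : X -> nat) r (I : X -> instance) :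
  FP mu I -> FP mu (fun x => demands r (I x)).
Proof.
move=> HI; apply: (FP_comp (g := demands r)) => //; rewrite /demands /demand /approvals; fp_lists.
all: by apply: FP_approved; fp.
Qed.

Lemma FP_affordable (X : Type) {HX : encodable X} (mu : X -> nat) r (I : X -> instance) :
  FP mu I -> FP mu (fun x => affordable r (I x)).
Proof. by move=> HI; have HD := FP_demands r HI; rewrite /affordable; fp_lists. Qed.

Lemma FP_start (X : Type) {HX : encodable X} (mu : X -> nat) r (I : X -> instance) :
  FP mu I -> FP mu (fun x => start r (I x)).
Proof.
move=> HI; have HD := FP_demands r HI; have HA := FP_affordable r HI.
by rewrite /start; have H0 := FP_mu HI; fp.
Qed.

Lemma esz_delete_vote t s : esz (delete_vote t s) <= esz s.
Proof.
rewrite !esz_pair /= ltnS; apply: leq_add; first by rewrite !esz_nat; lia.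
elim: s.2 => //= -[c n] d IH; rewrite !esz_cons !esz_pair !esz_nat /=.
by case: ifP => _; lia.
Qed.

(** One step at most about doubles the set, which is linear growth. Over all votes this would
    compound, so the outer fold relies on [esz_dp] instead. *)
Lemma FP_dp_step : FP esz (fun q : seq nat * seq state => dp_step q.2 q.1).
Proof.
apply: (FP_foldl_linear (c := 1) (F := fun q S' s => insert S' (delete_vote q.1 s))); fp_lists.
  rewrite /insert /delete_vote; fp_lists.
move=> [t S] S' s; rewrite /insert mul1n; case: ifP => _; first by rewrite leq_addr.
by rewrite esz_cons /= addnC -addnS leq_add2l ltnS; exact: esz_delete_vote.
Qed.

Lemma FP_satisfied : FP esz satisfied.
Proof. by rewrite /satisfied; fp_lists. Qed.

(** * Correctness and size of the dynamic program *)

Definition delete_votes (ts : seq (seq nat)) (s : state) : state :=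
  foldl (fun s t => delete_vote t s) s ts.

(** The closed form shows that a state depends only on how many votes are deleted and how often each
    candidate occurs in them. *)
Lemma delete_votesE ts s : delete_votes ts s =
  (s.1 - size ts, [seq (e.1, e.2 - count (fun t => e.1 \in t) ts) | e <- s.2]).
Proof.
elim: ts s => [|t ts IH] [b d] /=.
  by rewrite subn0; congr pair; rewrite -[LHS]map_id; apply: eq_map => -[c n]; rewrite subn0.
rewrite /delete_votes /= -/(delete_votes _ _) IH /= -map_comp; congr pair; first by rewrite subnS; lia.
by apply: eq_map => -[c n] /=; case: (c \in t); congr pair; lia.
Qed.

Lemma mem_insert S s s' : (s' \in insert S s) = (s' == s) || (s' \in S).
Proof. by rewrite /insert; case: ifP => [Hs|_]; rewrite ?inE //; case: eqP => // ->. Qed.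

Lemma dp_stepP S t s' :
  reflect (s' \in S \/ exists s, [/\ s \in S, s.1 != 0 & s' = delete_vote t s])
    (s' \in dp_step S t).
Proof.
rewrite /dp_step; set l := filter _ S.
have E S0 : (s' \in foldl (fun S' s => insert S' (delete_vote t s)) S0 l)
    = (s' \in S0) || (s' \in map (delete_vote t) l).
  elim: l S0 => [|s l IH] S0 /=; first by rewrite orbF.
  by rewrite IH mem_insert inE; case: (s' \in S0); rewrite ?orbT ?orbF.
rewrite E; apply: (iffP orP) => -[H|H]; try by left.
  by case/mapP: H => s; rewrite mem_filter => /andP[H1 H2] ->; right; exists s.
by case: H => s [H1 H2 ->]; right; apply: map_f; rewrite mem_filter H2.
Qed.

(** Budgets are truncated at 0, so [size T <= s.1] is recorded separately; it comes from the filter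
    in [dp_step]. *)
Lemma mem_dp ts S s' :
  s' \in foldl dp_step S ts <->
  exists s T, [/\ s \in S, subseq T ts, size T <= s.1 & s' = delete_votes T s].
Proof.
elim: ts S => [|t ts IH] S /=.
  split=> [H|[s [T [Hs /eqP -> _ ->]]]] //; by exists s', [::].
rewrite IH; split.
  move=> [s [T [/dp_stepP[H|[s0 [H0 H1 ->]]] HT Hsz ->]]].
    exists s, T; split=> //; exact: subseq_trans HT (subseq_cons _ _).
  exists s0, (t :: T); split; rewrite //= ?eqxx //.
  by move: Hsz H1 => /=; lia.
move=> [s [[|t' T] [Hs HT Hsz ->]]].
  by exists s, [::]; split; rewrite ?sub0seq //; apply/dp_stepP; left.
move: HT => /=; case: eqP => [->|_] HT.
  exists (delete_vote t s), T; split=> //; last by move: Hsz => /=; lia.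
  by apply/dp_stepP; right; exists s; split=> //; move: Hsz => /=; lia.
by exists s, (t' :: T); split=> //; apply/dp_stepP; left.
Qed.

Fixpoint demands_below (d : seq (nat * nat)) : seq (seq (nat * nat)) :=
  if d is e :: d' then [seq (e.1, k) :: d'' | k <- iota 0 e.2.+1, d'' <- demands_below d']
  else [:: [::]].

(** The length is the product of the [n + 1], and [n + 1 <= 2 ^ n]. *)
Lemma size_demands_below d : size (demands_below d) <= 2 ^ sumn [seq e.2 | e <- d].
Proof.
elim: d => // -[c n] d IH; rewrite [map _ _]/= [sumn _]/= expnD.
rewrite size_allpairs size_iota leq_mul //; exact: ltn_expl.
Qed.

Lemma mem_demands_below (g : nat * nat -> nat) d :
  [seq (e.1, e.2 - g e) | e <- d] \in demands_below d.
Proof.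
elim: d => // e d IH; apply/allpairsP; exists (e.2 - g e, [seq (e.1, e.2 - g e) | e <- d]).
by split; rewrite ?mem_iota //=; lia.
Qed.

Lemma uniq_dp ts S : uniq S -> uniq (foldl dp_step S ts).
Proof.
elim: ts S => //= t ts IH S0 H0; apply: IH; rewrite /dp_step.
move: (filter _ S0) => l; elim: l S0 H0 => //= s l IHl S0 H0; apply: IHl; rewrite /insert.
by case: ifP => //= ->.
Qed.

(** Distinct reachable states embed into budgets up to [s.1] times the vectors below [s.2]. The
    bound is independent of the number of votes, which is what yields fixed-parameter
    tractability. *)
Lemma size_dp ts s : size (foldl dp_step [:: s] ts) <= 2 ^ (s.1 + sumn [seq e.2 | e <- s.2]).
Proof.
rewrite expnD; apply: (@leq_trans (s.1.+1 * size (demands_below s.2))); last first.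
  apply: leq_mul; [exact: ltn_expl | exact: size_demands_below].
rewrite -[s.1.+1](size_iota 0) -(size_allpairs (fun b d => (b, d))).
apply: uniq_leq_size; first exact: uniq_dp.
move=> s' /mem_dp[s0 [T [/[!inE]/eqP -> _ _ ->]]]; rewrite delete_votesE.
apply: allpairs_f; first by rewrite mem_iota; lia.
exact: mem_demands_below.
Qed.

Lemma esz_delete_votes T s : esz (delete_votes T s) <= esz s.
Proof.
elim: T s => // t T IH s; exact: leq_trans (IH _) (esz_delete_vote _ _).
Qed.

Lemma esz_seq_le (A : eqType) {HA : encodable A} (l : seq A) W :
  {in l, forall a, esz a <= W} -> esz l <= size l * W.+1 + 1.
Proof.
move=> H; rewrite -{1}[l]map_id; apply: esz_map_le => l1 a l2 E.
by apply: H; rewrite E mem_cat mem_head orbT.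
Qed.

Lemma esz_dp ts s :
  esz (foldl dp_step [:: s] ts) <= 2 ^ (s.1 + sumn [seq e.2 | e <- s.2]) * (esz s).+1 + 1.
Proof.
apply: leq_trans (esz_seq_le (W := esz s) _) _.
  by move=> s' /mem_dp[s0 [T [/[!inE]/eqP -> _ _ ->]]]; apply: esz_delete_votes.
by rewrite leq_add2r leq_mul2r size_dp orbT.
Qed.

Lemma start_bound r I :
  (start r I).1 + sumn [seq e.2 | e <- (start r I).2] <= r.+1 * I.2.2.1.
Proof. by rewrite /start /= mulSn leq_add2l; case: ifP. Qed.

Lemma FP_decide (X : Type) {HX : encodable X} r (I : X -> instance) : FP esz I ->
  FP (fun x => esz x + 2 ^ (r.+1 * (I x).2.2.1)) (fun x => decide_dv r (I x)).
Proof.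
move=> HI; set mu := fun x => _.
have W (A : Type) (HA : encodable A) (f : X -> A) : FP esz f -> FP mu f.
  by apply: FP_weaken => x; apply: leq_addr.
have {}HI := W _ _ _ HI.
apply: FP_and; first exact: FP_affordable.
apply: FP_has; first by apply: FP_comp FP_satisfied _; fp.
have Hs := FP_start r HI; have H0 := FP_mu HI.
(* [mu x] dominates the number of states, and no state is larger than the start state. *)
apply: (FP_foldl_closed (h := fun x => mu x * (esz (start r (I x))).+1 + 1)).
- exact: FP_dp_step.
- exact: FP_tops.
- by fp.
- apply: poly_add (poly_const _ _); apply: poly_mul; first exact: poly_id.
  apply: (poly_le (h' := fun x => esz (start r (I x)) + 1)) => [|x]; last by rewrite addn1.
  by apply: poly_add (poly_const _ _); apply: FP_size.
move=> x l1 l2 _; apply: leq_trans (esz_dp _ _) _; rewrite leq_add2r leq_mul2r orFb.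
apply: leq_trans (leq_addl _ _); apply: leq_pexp2l => //; exact: start_bound.
Qed.

(** * Equivalence with the deletion problem *)

Lemma count_mask_negb (T : Type) (a : pred T) b s : size b = size s ->
  count a (mask b s) + count a (mask (map negb b) s) = count a s.
Proof.
elim: s b => [|x s IH] [|[] b] //= [Hb]; rewrite -(IH b Hb) /=; lia.
Qed.

(** Double counting: as [iota] has no repetitions, each [t] contributes at most its own length to
    the sum. *)
Lemma sum_count_le (ts : seq (seq nat)) r m : all (fun t => size t <= r) ts ->
  sumn [seq approvals c ts | c <- iota 0 m] <= r * size ts.
Proof.
elim: ts => [|t ts IH] /= => [_|/andP[Ht Hts]].
  by rewrite muln0; elim: (iota 0 m).
have -> : sumn [seq (c \in t) + approvals c ts | c <- iota 0 m]
    = count (mem t) (iota 0 m) + sumn [seq approvals c ts | c <- iota 0 m].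
  by elim: (iota 0 m) => //= c l ->; lia.
rewrite mulnS leq_add ?IH //; apply: leq_trans Ht; rewrite -size_filter.
by apply: uniq_leq_size => [|c]; rewrite ?filter_uniq ?iota_uniq // mem_filter => /andP[].
Qed.

(** Turns a choice of approval lists back into a choice of full votes. *)
Lemma subseq_map_lift (T T' : eqType) (f : T -> T') s u :
  subseq u (map f s) -> exists2 v, subseq v s & u = map f v.
Proof.
case/subseqP => b _ ->; exists (mask b s); last by rewrite map_mask.
exact: mask_subseq.
Qed.

Lemma sumn_le (l : seq nat) (f g : nat -> nat) :
  {in l, forall c, f c <= g c} -> sumn (map f l) <= sumn (map g l).
Proof.
elim: l => //= a l IH H; rewrite leq_add ?H ?mem_head // IH // => c Hc.
by apply: H; rewrite inE Hc orbT.
Qed.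


(** Only votes approving [p] are filtered out, so [c] loses at most [approvals p ts] of its
    approvals. This is the exchange argument for sparing those votes. *)
Lemma approvals_filter_le c p ts :
  approvals c ts <= approvals c [seq t : seq nat <- ts | p \notin t] + approvals p ts.
Proof.
rewrite /approvals; elim: ts => //= t ts IH.
by case: (p \in t); case E: (c \in t) => /=; rewrite ?E; lia.
Qed.

Lemma rDV_yesP r m p vs R (I := (m, (p, (R, vs)))) :
  rDV_yes r (DVI m p vs R) <-> exists T, [/\ subseq T (tops r I), size T <= R &
    forall c, c < m -> demand r I c <= approvals c T].
Proof.
have splitE (b : bitseq) (c : nat) : size b = size vs ->
    approvals c (map (take r) (mask b vs)) +
    score r (mask (map negb b) vs) c = approvals c (approved r I).
  by move=> Hb; rewrite /approvals /approved !count_map; apply: count_mask_negb.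
split=> [[b /= [Hb [HR Hw]]]|[T]].
  (* Of the deleted votes, only those not approving [p] are kept in [T]; by [approvals_filter_le]
     the demands are still met. *)
  exists [seq t : seq nat <- map (take r) (mask b vs) | p \notin t]; split.
  - rewrite subseq_filter filter_all; apply: subseq_trans (filter_subseq _ _) _.
    by apply: map_subseq; apply: mask_subseq.
  - by rewrite size_filter (leq_trans (count_size _ _)) // size_map size_mask.
  move=> c Hc; rewrite /demand /=; case: eqP => // /eqP ne.
  rewrite -(splitE b c Hb) -(splitE b p Hb).
  have := Hw c Hc ne; have := approvals_filter_le c p (map (take r) (mask b vs)).
  set x := approvals c [seq _ <- _ | _]; set y := approvals c _; set z := approvals p _.
  by move: x y z (score _ _ c) (score _ _ p) => x y z sc sp; lia.
rewrite subseq_filter => -[/andP[Hp /subseq_map_lift[U /subseqP[b Hb HU] ET]] HR HT].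
exists b; do 2!split=> //; first by rewrite -(size_mask Hb) -HU -(size_map (take r) U) -ET.
move=> c Hc ne; have := HT c Hc; rewrite /demand /= (negbTE ne).
rewrite -(splitE b c Hb) -(splitE b p Hb) -HU -ET.
(* Deleting [T] costs [p] nothing, so a met demand is exactly a strict win over [c]. *)
have -> : approvals p T = 0.
  by apply/eqP; rewrite -leqn0 leqNgt -has_count -all_predC.
move: (approvals c T) (score _ _ c) (score _ _ p) => x sc sp; lia.
Qed.

Lemma decide_dvP r m p vs R :
  decide_dv r (m, (p, (R, vs))) <-> rDV_yes r (DVI m p vs R).
Proof.
rewrite rDV_yesP; set I := (m, _); split.
  move=> /andP[HA /hasP[s /mem_dp[s0 [T [/[!inE]/eqP -> HT HR ->]]] Hs]].
  exists T; split=> // c Hc; move: Hs; rewrite delete_votesE /start HA /satisfied.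
  move/allP/(_ (c, demand r I c - approvals c T)); rewrite subn_eq0; apply.
  apply/mapP; exists (c, demand r I c) => //.
  by apply/mapP; exists c; rewrite // mem_iota.
(* A solution certifies affordability: at most [R] votes cover all demands, and each covers at most
   [r] units. *)
move=> [T [HT HR HD]]; have HA : affordable r I.
  rewrite /affordable /demands -map_comp.
  apply: leq_trans (sumn_le (g := approvals^~ T) _) _.
    by move=> c; rewrite mem_iota => /andP[_ /HD].
  apply: leq_trans (sum_count_le (r := r) _ _) _; last by rewrite leq_mul2l HR orbT.
  apply/allP => t /(mem_subseq HT); rewrite mem_filter => /andP[_ /mapP[v _ ->]].
  by rewrite size_take_min geq_minl.
apply/andP; split=> //; apply/hasP; exists (delete_votes T (start r I)).
  by apply/mem_dp; exists (start r I), T; rewrite inE.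
rewrite delete_votesE /start HA /satisfied all_map; apply/allP => _ /mapP[c Hc ->] /=.
by rewrite subn_eq0 HD //; move: Hc; rewrite mem_iota.
Qed.

(** * Turing machines *)

(* The first two steps of [machine M] write the home marker left of the input. *)
Definition machine (M : pm bool) : TM :=
  Build_TM (bool + (pq M + bool))%type sym (Some blankc)
    (Some [ffun i => if i == rB then Some false else None])
    (Some [ffun i => if i == rB then Some true else None])
    (inl false)
    (fun q => if q is inr (inr b) then Some b else None)
    (fun q a => match q with
     | inl false => (inl true, a, MoveL)
     | inl true => (inr (inl (pq0 M)), None, MoveN)
     | inr (inl q') => let: (o, b, m) := pd q' a in (inr o, b, m)
     | inr (inr _) => (q, a, MoveN)
     end).

Definition conf (M : pm bool) (q : tm_Q (machine M)) (t : tape) : config (machine M) :=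
  @Config (machine M) q t.1.1 t.1.2 t.2.

Lemma runs_step_conf (M : pm bool) q t o a m : pd q t.1.2 = (o, a, m) ->
  step (@conf M (inr (inl q)) t) = conf (inr o) (act a m t).
Proof. by case: t => [[l h] r] /= E; rewrite /step /= E; case: m {E}; case: l; case: r. Qed.

Lemma runs_iter (M : pm bool) q t n b t' : runs q t n b t' ->
  iter n (@step (machine M)) (@conf M (inr (inl q)) t) = conf (inr (inr b)) t'.
Proof.
elim=> {q t n b t'} [q t x a m Hd|q t q' a m n x t' Hd _ IH].
  by rewrite /= (runs_step_conf Hd).
by rewrite iterSr (runs_step_conf Hd).
Qed.

(** The first input bit lies next to the marker, at the bottom of track [rB], so the stack read from
    its top is [rev w]. The final 2 counts the steps that write the marker. *)
Lemma exec_halts (M : pm bool) w n b s' :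
  exec M [:: [::]; [::]; [::]; rev w; [::]] n b s' ->
  halts_with (machine M) w (n * (2 * (size w + n) + 6) + 2) b.
Proof.
(* On the empty word the head starts on a blank, which becomes a cell to the right of the marker. *)
move=> [H]; pose r : seq cell := if w is [::] then [:: blankc] else
  [seq [ffun i => if i == rB then Some x else None] | x <- w].
have Hr : rep r [:: [::]; [::]; [::]; rev w; [::]].
  move=> i j.
  have -> : nth blankc r j i = if i == rB then onth w j else None.
    rewrite /r; case: w {H r} => [|x w]; first by case: j => [|[|j]]; rewrite /= ffunE if_same.
    case: (ltnP j (size (x :: w))) => Hj.
      rewrite (nth_map x) // ffunE; case: eqP => // _.
      by rewrite onthE (nth_map x).
    by rewrite nth_default ?size_map // ffunE onth_default // if_same.
  by case: i => -[|[|[|[|[|i]]]]] //= Hi; rewrite /stack /= ?revK ?onth0n.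
have [i|_ [k [r' [Hk _ Hruns]]]] := H (size w) [::] r _ Hr.
  by case: i => [|[|[|[|[|i]]]]] //; rewrite /stack /= ?size_rev ?nth_nil.
exists k.+2; split; first lia.
have -> : iter k.+2 (@step (machine M)) (init (machine M) w)
    = iter k (@step (machine M)) (conf (inr (inl (pq0 M))) (home [::] r)).
  rewrite !iterSr; congr (iter k _ _); rewrite /r /init /home.
  case: w {H r Hr Hk Hruns} => [|x w] //=; rewrite /step /= /conf /=; congr Config.
  rewrite -!map_comp /=; congr cons; first by case: x.
  by apply: eq_map => -[].
by rewrite (runs_iter Hruns).
Qed.

(** * From polynomial-time functions to deciding machines *)

Definition pm_read_bits : pm unit :=
  pm_loop (pm_bind (pm_pop rB) (fun o => match o with
    | Some true => pm_puts (true :: code (tbool true)) ;; pm_ret None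
    | Some false => pm_puts (true :: code (tbool false)) ;; pm_ret None
    | None => pm_ret (Some tt)
    end)).

(** The last bit comes off first and each bit is consed in front, so the list ends up in input
    order. *)
Lemma exec_read_bits u (w : seq bool) :
  exec pm_read_bits [:: code (enc w); [::]; [::]; u; [::]] (7 * size u + 2) tt
    (st (code (enc (rev u ++ w))) [::]).
Proof.
elim: u w => [|b u IH] w.
  by apply: exec_loop_exit; apply: (exec_bind (n := 1) (n' := 1) (exec_pop rB _)); apply: exec_ret.
rewrite [size _]/= mulnS -addnA rev_cons cat_rcons; apply: exec_loop_next (IH (b :: w)).
apply: (exec_bind (n := 1) (n' := 6) (exec_pop rB _)); case: b.
  by apply: (exec_bind (n := 5) (n' := 1)); [exact: exec_puts | exact: exec_ret].
apply: (exec_le (n := 4)) => //.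
by apply: (exec_bind (n := 3) (n' := 1)); [exact: exec_puts | exact: exec_ret].
Qed.

Definition pm_read : pm unit := pm_push rD false ;; pm_read_bits.

Lemma exec_read w : exec pm_read [:: [::]; [::]; [::]; rev w; [::]] (7 * size w + 3) tt
  (st (code (enc w)) [::]).
Proof.
have -> : 7 * size w + 3 = 1 + (7 * size (rev w) + 2) by rewrite size_rev; lia.
apply: exec_bind (exec_push rD _ _) _.
by have := exec_read_bits (rev w) [::]; rewrite revK cats0.
Qed.

Lemma esz_word (w : seq bool) : esz w <= 4 * size w + 1.
Proof. by elim: w => // b w IH; rewrite esz_cons /=; have := esz_bool b; lia. Qed.

Lemma FP_halts (mu : seq bool -> nat) (f : seq bool -> bool) : FP mu f ->
  exists M k, forall w, halts_with M w ((mu w).+2 ^ k) (f w).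
Proof.
move=> [H0 [M [T [HT HM]]]].
(* The first symbol in the code of a boolean is that boolean, so one pop gives the verdict. *)
pose N := pm_read ;; M ;; pm_bind (pm_pop rD) (fun o => pm_ret (o == Some true)).
pose n (w : seq bool) : nat := 7 * @esz _ (@encodable_seq _ encodable_bool) w + 3 + (T w + 2).
have Hn : poly mu n.
  have P := poly_mul (poly_const mu _).
  exact: poly_add (poly_add (P _ _ H0) (poly_const _ _)) (poly_add HT (poly_const _ _)).
have [k Hk] : poly mu (fun w => n w * (2 * (esz w + n w) + 6) + 2).
  have P := poly_mul (poly_const mu _).
  apply: poly_add (poly_mul Hn (poly_add (P _ _ (poly_add H0 Hn)) (poly_const _ _))) (poly_const _ _).
exists (machine N), k => w.
have HN : exec N [:: [::]; [::]; [::]; rev w; [::]] (n w) (f w)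
    (st (behead (code (enc (f w)))) [::]).
  apply: exec_bind.
    apply: exec_le _ (exec_read w); rewrite leq_add2r leq_mul2l; exact: size_esz.
  have := HM w [::] [::]; rewrite !cats0 => HMw.
  apply: exec_bind HMw _; apply: (exec_bind (n := 1) (n' := 1) (exec_pop rD _)).
  by case: (f w); apply: exec_ret.
have [j [Hj Hh]] := exec_halts HN.
exists j; split=> //; apply: leq_trans Hj (leq_trans _ (Hk w)).
rewrite leq_add2r leq_mul2l; apply/orP; right.
have Hw : size w <= esz w by apply: size_esz.
by rewrite leq_add2r leq_mul2l leq_add2r Hw.
Qed.

(** In unary the value is itself exponentially long, so it is part of the measure; then repeated
    doubling stays within bounds. *)
Lemma FP_pow2 (X : Type) {HX : encodable X} (n : X -> nat) : FP esz n ->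
  FP (fun x => esz x + 2 ^ n x) (fun x => 2 ^ n x).
Proof.
move=> Hn; have {}Hn : FP (fun x => esz x + 2 ^ n x) n.
  by apply: FP_weaken Hn => x; apply: leq_addr.
have E k : iter k (fun y => y + y) 1 = 2 ^ k by elim: k => //= k ->; rewrite expnS; lia.
apply: (FP_ext (f := fun x => iter (n x) (fun y => y + y) 1)) => [x|]; first exact: E.
have H0 := FP_mu Hn.
apply: (FP_iter (h := fun x => 2 * (esz x + 2 ^ n x) + 1)) => //; fp_lists.
  exact: poly_add (poly_mul (poly_const _ _) (poly_id _)) (poly_const _ _).
move=> x i Hi; rewrite E esz_nat; have : 2 ^ i <= 2 ^ n x by apply: leq_pexp2l.
lia.
Qed.

(** Both numbers are decoded from the word and the power is compared with the second; only halting
    is demanded, so exponential time is harmless. *)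
Lemma pow2_computable A B : tm_computable (fun k => 2 ^ (A * k + B)).
Proof.
pose e w := A * head 0 (numbers w) + B.
have He : FP esz e.
  by have H := FP_numbers (FP_id (poly_id (@esz (seq bool) (@encodable_seq _ encodable_bool)))); rewrite /e; fp_lists.
have Hn : FP (fun w => esz w + 2 ^ e w) (fun w => head 0 (behead (numbers w))).
  apply: FP_weaken (_ : FP esz _) => [w|]; first exact: leq_addr.
  by have H := FP_numbers (FP_id (poly_id (@esz (seq bool) (@encodable_seq _ encodable_bool)))); fp_lists.
have [M [j HM]] := FP_halts (FP_eq (FP_pow2 He) Hn).
exists M => k n; set w := _ ++ _; exists ((esz w + 2 ^ e w).+2 ^ j).
have := HM w; rewrite /e.
by have -> : numbers w = [:: k; n] by rewrite -(numbersK [:: k; n]) /= cats0.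
Qed.

Lemma parse_encode I : dv_valid I ->
  parse (encode_instance I) = (dv_m I, (dv_p I, (dv_R I, dv_votes I))).
Proof.
case: I => m p vs R [/= Hp [Hv _]]; rewrite /parse.
have -> : encode_instance (DVI m p vs R) = flatten (map enc_nat
    [:: m, p, R, size vs & flatten [seq size v :: v | v <- vs]]).
  rewrite /encode_instance /=; do 4!congr cat.
  by elim: vs {Hv} => //= v vs ->; rewrite /enc_list map_cat flatten_cat catA.
rewrite numbersK /= chunksK //; apply: sub_all Hv => v /perm_size ->.
by rewrite size_iota (leq_ltn_trans _ Hp).
Qed.

Theorem theorem6 : forall r : nat, 1 <= r ->
  FPT dv_valid encode_instance dv_R (rDV_yes r).
Proof.
move=> r _; have Hp := FP_parse (FP_id (poly_id (@esz (seq bool) (@encodable_seq _ encodable_bool)))).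
have [M [K HM]] := FP_halts (FP_decide r Hp).
(* The base satisfies [(mu w).+2 <= 8 * 2 ^ (r.+1 * R) * (size w).+1], because
   [esz w <= 4 * size w + 1]. Raising this to the power [K] gives the function and the exponent; the
   3 comes from 8 = 2^3. *)
exists M, (fun R => 2 ^ (r.+1 * K * R + 3 * K)), K; split; first exact: pow2_computable.
move=> I HI; have := HM (encode_instance I); rewrite parse_encode //=.
case: I HI => m p vs R HI /=; set w := encode_instance _ => -[j [Hj Hh]].
exists (decide_dv r (m, (p, (R, vs)))); split; last exact: decide_dvP.
exists j; split=> //; apply: leq_trans Hj _.
have -> : r.+1 * K * R + 3 * K = (r.+1 * R + 3) * K by lia.
rewrite [2 ^ (_ * K)]expnM -expnMn; apply: leq_expl; rewrite expnD.
have := esz_word w; have : 0 < 2 ^ (r.+1 * R) by rewrite expn_gt0.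
nia.
Qed.
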